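(* There do not exist constants $C>0$, $p>0$, $\kappa>0$ such that for every dimension $n$ there exists an algorithm with complexity $O(n^\kappa)$ which is correct in estimating the volume of convex bodies in $\mathbb{R}^n$ up to $C$ with probability $p$.
   Context: An algorithm (using the random point oracle) for convex bodies in $\mathbb{R}^n$ is a possibly randomized function whose input is a finite sequence of points drawn independently according to the uniform probability measure on a convex body $K\subset\mathbb{R}^n$ and whose output is a real number (meant as an estimate of $\mathrm{Vol}(K)$). Its complexity is the length of the input sequence; complexity $O(n^\kappa)$ means the length is at most a constant (independent of $n$) times $n^\kappa$. The algorithm is correct up to $C$ with probability $p$ if for every convex body $K\subset\mathbb{R}^n$, when given the sequence of random points from $K$, its output lies in $[\mathrm{Vol}(K)/C,\ C\,\mathrm{Vol}(K)]$ with probability at least $p$. *)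

(* Defs.v *)
From HB Require Import structures.
From mathcomp Require Import all_boot all_order all_algebra.
From mathcomp Require Import all_classical all_reals all_analysis.
Import Order.TTheory GRing.Theory Num.Theory.
Import numFieldNormedType.Exports.
Local Open Scope classical_set_scope.
Local Open Scope ring_scope.

Definition box {R : realType} {I : finType} (ab : (I -> R) * (I -> R)) : set (I -> R) :=
  [set x | forall i, ab.1 i <= x i <= ab.2 i].

Definition box_vol {R : realType} {I : finType} (ab : (I -> R) * (I -> R)) : \bar R :=
  (\prod_(i : I) (ab.2 i - ab.1 i))%:E.

Definition leb_outer {R : realType} {I : finType} (A : set (I -> R)) : \bar R :=
  ereal_inf [set \esum_(ab in F) box_vol ab |
     F in [set F : set ((I -> R) * (I -> R)) |
             [/\ countable F,
                 (forall ab, F ab -> forall i, ab.1 i <= ab.2 i) &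
                 A `<=` \bigcup_(ab in F) box ab]]].

Definition volume {R : realType} {n : nat} (K : set 'rV[R]_n) : \bar R :=
  leb_outer [set x : 'I_n -> R | K (\row_i x i)].

Definition convex_body {R : realType} {n : nat} (K : set 'rV[R]_n) : Prop :=
  [/\ compact K, (interior K !=set0) &
      forall x y (t : R), K x -> K y -> 0 <= t <= 1 -> K (t *: x + (1 - t) *: y)].

Definition borel_fun {R : realType} {T : topologicalType} (f : T -> R) : Prop :=
  forall U : set R, open U -> <<s [set V : set T | open V] >> (f @^-1` U).

(* A set of (sample, seed) pairs, where the sample is an N x n matrix whose
   rows are the N points of R^n and the seed is a real number, viewed as a
   subset of R^((N x n) + 1) in order to measure it. *)
Definition sample_seed_set {R : realType} {N n : nat}
    (X : set ('M[R]_(N, n) * R)) : set (('I_N * 'I_n + unit)%type -> R) :=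
  [set x | X (\matrix_(k, i) x (inl (k, i)), x (inr tt))].

(* Randomized algorithm with N random-point-oracle queries in dimension n:
   f (X, u) is the output on input points X (rows) and internal randomness
   u uniform on [0,1].  It is correct up to C with probability p if for
   every convex body K, with X uniform on K^N and u uniform on [0,1]
   independent, P(Vol K / C <= f (X,u) <= C Vol K) >= p, i.e.
   Leb({(X,u) in K^N x [0,1] | success}) >= p * Vol(K)^N. *)
Definition correct_with_prob {R : realType} {N n : nat}
    (f : 'M[R]_(N, n) * R -> R) (C p : R) : Prop :=
  forall K : set 'rV[R]_n, convex_body K ->
    let V := fine (volume K) in
    ((p * V ^+ N)%:E <=
      leb_outer (sample_seed_set
        [set Xu : 'M[R]_(N, n) * R | (forall k : 'I_N, K (row k Xu.1)) /\ 0 <= Xu.2 <= 1 /\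
                  V / C <= f Xu <= C * V]%R))%E.

(* Main.v *)
(** The cube [0,1]^dim is cut by a random family of halfspaces {S >= -ln U}, S being a
    sum of coordinates, one per block of a random selection of blocks.  A point x is
    removed by such a cut at a rate proportional to a product of block means of e^-x.
    These means concentrate, so each normalised product s_r is close to 1, and the rates
    can be chosen so that x survives with probability about e^(-H_a x),
      H_a = L m (prod_r (1 + s_r) - 1) + L a (1 - prod_r (1 - s_r)).
    The last product is smaller than any prescribed power of dim, so the surviving
    densities for a = 0, ..., m - 1 are nearly proportional, although their integrals differ by
    factors e^L > 4 C^2.  Cuts being included independently, N points survive jointly
    with at least the product of their probabilities; conversely two points are seldom
    hit by a common cut, because (E e^(-x/2))^2 < E e^-x, so the N-th moment of the volume
    is nearly the N-th power of its mean.  Hence the volume concentrates and N points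
    drawn from the random bodies have nearly the same law for all a: the m disjoint events
    "the output is near the a-th volume" would all have probability about p, which is
    absurd when m p > 4. *)
Require Import Defs.
From HB Require Import structures.
From mathcomp Require Import all_boot all_order all_algebra.
From mathcomp Require Import all_classical all_reals all_analysis.
From mathcomp Require Import measurable_realfun ring lra zify.
Import Order.TTheory GRing.Theory Num.Theory.
Import numFieldNormedType.Exports.
Local Open Scope classical_set_scope.
Local Open Scope ring_scope.

(** * Outer Lebesgue measure *)

(** Three requirements fix the shape. The error in the survival density of one point is multiplied
    by the number N of samples, so it must beat a prescribed power of dim; a product of k
    independent deviations, each of mean order 1/B with dim at most B^5, does so once k exceeds the
    exponent of N. Expanding L a (1 - prod_r (1 - s_r)) gives coefficients of both signs, while
    rates are nonnegative; the term L m (prod_r (1 + s_r) - 1), the same for every a, absorbs the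
    negative ones. Finally two points must rarely share a cut: with T blocks per group the rate of
    this is, up to a logarithm, of order (b^2 / y)^T, where y = E e^-x and b = E e^(-x/2). This is
    polynomially small in B for T of order log B, whereas the block products still concentrate
    because T is tiny compared with the block size B^4. The mean volumes stay above a positive
    constant, since L, m and k do not depend on B, so all these errors are small relative to the
    volumes. *)

Lemma esum_image_le (R : realType) (T T' : choiceType) (F : set T) (g : T -> T')
    (a : T' -> \bar R) : (forall t, F t -> 0 <= a (g t))%E ->
  (\esum_(i in g @` F) a i <= \esum_(j in F) a (g j))%E.
Proof.
move=> a0.
have [->|/set0P[x0 _]] := eqVneq F set0; first by rewrite image_set0 !esum_set0.
have /choice[h hP] : forall y, exists x, (g @` F) y -> F x /\ g x = y.
  move=> y; have [[x Fx gx]|ny] := pselect ((g @` F) y); first by exists x.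
  by exists x0.
(* [J] holds one preimage of each value, so [g] is injective on it. *)
pose J := h @` (g @` F).
have JF : J `<=` F by move=> _ [y /hP[Fy _] <-].
have gJ : g @` J = g @` F.
  apply/seteqP; split => [_ [_ [y /hP[Fy gy] <-] <-]|y gy]; first by exists (h y).
  by have [Fy gyE] := hP _ gy; exists (h y) => //; exists y.
rewrite -gJ esum_image; last first.
  move=> x y; rewrite !inE => -[u gu <-] [v gv <-].
  by have [_ ->] := hP _ gu; have [_ ->] := hP _ gv; move=> ->.
rewrite (esumID J F)//.
rewrite (_ : F `&` J = J); last by apply/setIidr.
by rewrite leeDl// esum_ge0// => i [Fi _]; exact: a0.
Qed.

Section leb_outer.
Context {R : realType} {I : finType}.
Implicit Types (A X : set (I -> R)) (ab : (I -> R) * (I -> R)).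
Local Notation lo := (@leb_outer R I).

Lemma box_vol_ge0 ab : (forall i, ab.1 i <= ab.2 i) -> (0 <= box_vol ab :> \bar R)%E.
Proof. by move=> h; rewrite lee_fin prodr_ge0// => i _; rewrite subr_ge0. Qed.

Lemma leb_outer_ge0 A : (0 <= lo A)%E.
Proof.
apply: le_ereal_inf_tmp => _ [F [_ h _] <-].
by apply: esum_ge0 => ab /h/box_vol_ge0.
Qed.

(** Covers in [leb_outer] are sets of boxes; this form accepts indexed covers, in which a box may be
    repeated. *)
Lemma leb_outer_le A (J : choiceType) (F : set J) (g : J -> (I -> R) * (I -> R)) :
  countable F -> (forall j, F j -> forall i, (g j).1 i <= (g j).2 i) ->
  A `<=` \bigcup_(j in F) box (g j) -> (lo A <= \esum_(j in F) box_vol (g j))%E.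
Proof.
move=> cF h AF; apply: (@le_trans _ _ (\esum_(ab in g @` F) box_vol ab)); last first.
  by apply: esum_image_le => t /h/box_vol_ge0.
apply: ereal_inf_lbound; exists (g @` F) => //; split.
- exact: sub_countable (card_image_le _ _) cF.
- by move=> _ [j Fj <-]; exact: h.
- by move=> x /AF[j Fj gx]; exists (g j) => //; exists j.
Qed.

Lemma leb_outer_set0 : lo set0 = 0%E.
Proof.
apply/eqP; rewrite eq_le leb_outer_ge0 andbT.
have := @leb_outer_le set0 nat set0 (fun=> (fun=> 0, fun=> 0)).
by rewrite esum_set0; apply => // x [].
Qed.

Lemma leb_outer_mono : {homo lo : A B / A `<=` B >-> (A <= B)%E}.
Proof.
move=> A B AB; apply: le_ereal_inf => _ [F [cF h BF] <-].
by exists F => //; split => //; exact: subset_trans BF.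
Qed.

Lemma leb_outer_adherent A (e : R) : 0 < e -> (lo A < +oo)%E ->
  exists F, [/\ countable F, (forall ab, F ab -> forall i, ab.1 i <= ab.2 i),
    A `<=` \bigcup_(ab in F) box ab & (\esum_(ab in F) box_vol ab <= lo A + e%:E)%E].
Proof.
move=> e0 fA; have fin : lo A \is a fin_num by rewrite ge0_fin_numE// leb_outer_ge0.
have [_ [F [cF h AF] <-] lt] := lb_ereal_inf_adherent e0 fin.
by exists F; split => //; exact: ltW.
Qed.

Lemma leb_outer_sigma_subadditive : sigma_subadditive lo.
Proof.
move=> A; have [[i ioo]|] := pselect (exists i, lo (A i) = +oo%E).
  rewrite (eseries_pinfty _ _ ioo) ?leey// => n _.
  by rewrite -ltNye (lt_le_trans _ (leb_outer_ge0 _)).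
rewrite -forallNE => Aoo; apply/lee_addgt0Pr => e e0.
rewrite (le_trans _ (epsilon_trick _ _ (ltW e0)))//; last first.
  by move=> n; exact: leb_outer_ge0.
have /choice[F FP] : forall n, exists F, [/\ countable F,
    (forall ab, F ab -> forall i, ab.1 i <= ab.2 i),
    A n `<=` \bigcup_(ab in F) box ab &
    (\esum_(ab in F) box_vol ab <= lo (A n) + (e / (2 ^ n.+1)%:R)%:E)%E].
  move=> n; apply: leb_outer_adherent; first by rewrite divr_gt0.
  by rewrite ltey; apply/eqP/Aoo.
apply: (@le_trans _ _ (\esum_(k in [set: nat] `*`` F) box_vol k.2)).
  apply: leb_outer_le.
  - apply: countableXR => [|i _]; [exact: countableP|by have [] := FP i].
  - by move=> [n ab] [_ Fab]; have [_ + _ _] := FP n; apply.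
  - move=> x [n _ Anx]; have [_ _ + _] := FP n => /(_ x Anx)[ab Fab abx].
    by exists (n, ab).
rewrite -(@esum_esum _ _ _ _ F (fun _ ab => box_vol ab)); last first.
  by move=> n ab _ Fab; apply: box_vol_ge0; have [_ + _ _] := FP n; apply.
rewrite nneseries_esumT; last first.
  by move=> n; rewrite adde_ge0 ?leb_outer_ge0// lee_fin divr_ge0// ltW.
by apply: le_esum => n _; have [_ _ _] := FP n.
Qed.

HB.instance Definition _ := isOuterMeasure.Build R (I -> R) lo
  leb_outer_set0 leb_outer_ge0 leb_outer_mono leb_outer_sigma_subadditive.

Definition fupd (a : I -> R) i c : I -> R := fun j => if j == i then c else a j.

Lemma box_vol_fupd (a b : I -> R) i u v :
  box_vol (fupd a i u, fupd b i v) =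
  ((v - u) * \prod_(j | j != i) (b j - a j))%:E.
Proof.
rewrite /box_vol (bigD1 i)//= /fupd eqxx; congr (_ * _)%:E.
by apply: eq_bigr => j /negPf ->.
Qed.

Lemma fupd_id (a : I -> R) i : fupd a i (a i) = a.
Proof. by apply/funext => j; rewrite /fupd; case: eqP => // ->. Qed.

(** The hyperplane x i = c cuts each covering box into two boxes whose volumes add up to at most its
    own. [F1] and [F2] select the boxes that reach the respective side. *)
Lemma leb_outer_caratheodory_halfspace i c :
  lo.-caratheodory [set x : I -> R | x i < c].
Proof.
apply: (@le_caratheodory_measurable _ _ lo) => X.
have [h|fX] := eqVneq (lo X) +oo%E; first by rewrite [leRHS]h leey.
apply/lee_addgt0Pr => e e0.
have [F [cF h XF Fle]] := leb_outer_adherent _ _ e0 (ltac:(by rewrite ltey) : (lo X < +oo)%E).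
apply: le_trans Fle.
pose F1 := F `&` [set ab | ab.1 i <= c]; pose F2 := F `&` [set ab | c <= ab.2 i].
pose g1 ab : (I -> R) * (I -> R) := (ab.1, fupd ab.2 i (Num.min (ab.2 i) c)).
pose g2 ab : (I -> R) * (I -> R) := (fupd ab.1 i (Num.max (ab.1 i) c), ab.2).
have g1h ab : F1 ab -> forall j, (g1 ab).1 j <= (g1 ab).2 j.
  move=> [/h abh /= ac] j; rewrite /fupd; case: eqP => [->|//].
  by rewrite le_min abh ac.
have g2h ab : F2 ab -> forall j, (g2 ab).1 j <= (g2 ab).2 j.
  move=> [/h abh /= ac] j; rewrite /fupd; case: eqP => [->|//].
  by rewrite ge_max abh ac.
have H1 : (lo (X `&` [set x : I -> R | (x i < c)%R]) <= \esum_(ab in F1) box_vol (g1 ab))%E.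
  apply: leb_outer_le => //; first exact: sub_countable (subset_card_le (@subIsetl _ _ _)) cF.
  move=> x [/XF [ab Fab abx] /= xc]; exists ab.
    by split => //=; apply: le_trans (ltW xc); case/andP: (abx i).
  move=> j; rewrite /= /fupd; case: eqP => [->|_]; last exact: abx.
  by case/andP: (abx i) => -> /=; rewrite le_min => ->; rewrite ltW.
have H2 : (lo (X `&` ~` [set x : I -> R | (x i < c)%R]) <= \esum_(ab in F2) box_vol (g2 ab))%E.
  apply: leb_outer_le => //; first exact: sub_countable (subset_card_le (@subIsetl _ _ _)) cF.
  move=> x [/XF [ab Fab abx] /= /negP]; rewrite -leNgt => xc; exists ab.
    by split => //=; apply: (le_trans xc); case/andP: (abx i).
  move=> j; rewrite /= /fupd; case: eqP => [->|_]; last exact: abx.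
  by case/andP: (abx i) => + -> /=; rewrite ge_max => ->; rewrite xc.
apply: (le_trans (leeD H1 H2)); rewrite !esum_mkcondr -esumD.
- apply: le_esum => ab Fab; have abh := h _ Fab.
  have P0 : 0 <= \prod_(j | j != i) (ab.2 j - ab.1 j).
    by apply: prodr_ge0 => j _; rewrite subr_ge0.
  have V u v : box_vol (fupd ab.1 i u, fupd ab.2 i v) =
      ((v - u) * \prod_(j | j != i) (ab.2 j - ab.1 j))%:E := box_vol_fupd _ _ _ _ _.
  have -> : box_vol ab = ((ab.2 i - ab.1 i) * \prod_(j | j != i) (ab.2 j - ab.1 j))%:E.
    by rewrite -V !fupd_id; case: (ab).
  have -> : box_vol (g1 ab) = ((Num.min (ab.2 i) c - ab.1 i) * \prod_(j | j != i) (ab.2 j - ab.1 j))%:E.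
    by rewrite -V fupd_id.
  have -> : box_vol (g2 ab) = ((ab.2 i - Num.max (ab.1 i) c) * \prod_(j | j != i) (ab.2 j - ab.1 j))%:E.
    by rewrite -V fupd_id.
  have := abh i; set al := ab.1 i; set be := ab.2 i => albe.
  set p := \prod_(j | _) _ in P0 *.
  have M1 : Num.min be c <= be by rewrite ge_min lexx.
  have M2 : al <= Num.max al c by rewrite le_max lexx.
  have M3 : Num.min be c - Num.max al c <= 0.
    by rewrite subr_le0 ge_min; apply/orP; right; rewrite le_max lexx orbT.
  case: ifPn => _; case: ifPn => _;
    rewrite ?addr0 ?add0r -?EFinD lee_fin -?mulrDl ?mulr_ge0 ?ler_wpM2r//; lra.
- move=> ab Fab; case: ifPn => //; rewrite inE/= => c1.
  by apply: box_vol_ge0; apply: g1h.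
- move=> ab Fab; case: ifPn => //; rewrite inE/= => c1.
  by apply: box_vol_ge0; apply: g2h.
Qed.

End leb_outer.

(** The Borel sigma-algebra of R^I, generated by sets whose Caratheodory property has a direct
    proof. *)
Definition coord_sigma {R : realType} {I : finType} : set (set (I -> R)) :=
  <<s [set A | exists i c, A = [set x : I -> R | x i < c]] >>.

Lemma coord_sigma_caratheodory {R : realType} {I : finType} (A : set (I -> R)) :
  coord_sigma A -> (@leb_outer R I).-caratheodory A.
Proof.
apply; split; first split.
- exact: caratheodory_measurable_set0.
- by move=> B hB; rewrite setTD; exact: caratheodory_measurable_setC.
- exact: caratheodory_measurable_bigcup.
- by move=> _ [i [c ->]]; exact: leb_outer_caratheodory_halfspace.
Qed.

Section coord_sigma.
Context {R : realType} {I : finType}.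
Implicit Types (A B : set (I -> R)).
Let G : set (set (I -> R)) := [set A | exists i c, A = [set x : I -> R | x i < c]].

Lemma coord_sigmaC A : coord_sigma A -> coord_sigma (~` A).
Proof. exact: (@measurableC _ (g_sigma_algebraType G)). Qed.

Lemma coord_sigmaI A B : coord_sigma A -> coord_sigma B -> coord_sigma (A `&` B).
Proof. exact: (@measurableI _ (g_sigma_algebraType G)). Qed.

Lemma coord_sigma_bigcup (F : (set (I -> R))^nat) :
  (forall n, coord_sigma (F n)) -> coord_sigma (\bigcup_n F n).
Proof. by move=> h; apply: (@bigcupT_measurable _ (g_sigma_algebraType G)). Qed.

Lemma coord_sigma_forall (J : finType) (F : J -> set (I -> R)) :
  (forall j, coord_sigma (F j)) -> coord_sigma [set x | forall j, F j x].
Proof.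
move=> h; rewrite (_ : [set x | _] = \big[setI/setT]_(j <- enum J) F j).
  by apply: (@bigsetI_measurable _ (g_sigma_algebraType G)) => j _; exact: h.
rewrite -bigcap_seq; apply/seteqP; split => [x xF j _|x xF j]; first exact: xF.
by apply: xF; rewrite /= mem_enum.
Qed.

Lemma coord_sigma_lt i c : coord_sigma [set x : I -> R | x i < c].
Proof. by apply: sub_sigma_algebra; exists i, c. Qed.

Lemma coord_sigma_ge i c : coord_sigma [set x : I -> R | c <= x i].
Proof.
rewrite (_ : [set x | _] = ~` [set x : I -> R | x i < c]); last first.
  by apply/seteqP; split => x /=; rewrite leNgt => /negP.
by apply: coord_sigmaC; exact: coord_sigma_lt.
Qed.

(** An open set is the union of the half-open boxes with rational corners that it contains. Openness
    is phrased with the sup-distance, so that no topology on [I -> R] is involved. *)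
Lemma coord_sigma_open A :
  (forall x, A x -> exists2 e : R, 0 < e &
     forall y : I -> R, (forall i, `|y i - x i| < e) -> A y) -> coord_sigma A.
Proof.
move=> hA.
pose B (ab : {ffun I -> rat} * {ffun I -> rat}) : set (I -> R) :=
  [set x | forall i, ratr (ab.1 i) <= x i /\ x i < ratr (ab.2 i)].
have mB ab : coord_sigma (B ab).
  apply: (@coord_sigma_forall I (fun i => [set x : I -> R | ratr (ab.1 i) <= x i] `&`
     [set x : I -> R | x i < ratr (ab.2 i)])) => i.
  by apply: coord_sigmaI; [exact: coord_sigma_ge|exact: coord_sigma_lt].
(* Codes of no pair of corners, or of a box that leaves [A], contribute the empty set. *)
pose F n : set (I -> R) := if unpickle n is Some ab
   then (if `[< B ab `<=` A >] then B ab else set0) else set0.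
rewrite (_ : A = \bigcup_n F n).
  apply: coord_sigma_bigcup => n; rewrite /F.
  have c0 : coord_sigma (set0 : set (I -> R)).
    exact: (@measurable0 _ (g_sigma_algebraType G)).
  by case: unpickle => [ab|//]; case: ifP.
apply/seteqP; split => [x Ax|x [n _]]; last first.
  by rewrite /F; case: unpickle => [ab|//]; case: ifPn => // /asboolP; exact.
have [e e0 he] := hA x Ax.
have h1 i : exists q : rat, x i - e < ratr q <= x i.
  have [|q] := @rat_in_itvoo R (x i - e) (x i); first by lra.
  by rewrite in_itv/= => /andP[q1 /ltW q2]; exists q; rewrite q1 q2.
have h2 i : exists q : rat, x i < ratr q < x i + e.
  have [|q] := @rat_in_itvoo R (x i) (x i + e); first by lra.
  by rewrite in_itv/=; exists q.
have [a ha] := choice h1; have [b hb] := choice h2.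
exists (pickle ([ffun i => a i], [ffun i => b i])) => //.
rewrite /F pickleK; case: ifPn => [_ i|/asboolP[]] /=.
  by rewrite !ffunE; case/andP: (ha i) => _ ->; case/andP: (hb i).
move=> y /= hy; apply: he => i.
by have := hy i; rewrite /= !ffunE => -[]; have := ha i; have := hb i; rewrite ltr_norml; lra.
Qed.

Lemma coord_sigma_borel (T : pseudoMetricType R) (g : (I -> R) -> T) :
  (forall x e, 0 < e -> exists2 r : R, 0 < r &
     forall y : I -> R, (forall i, `|y i - x i| < r) -> ball (g x) e (g y)) ->
  forall V, <<s [set V : set T | open V] >> V -> coord_sigma (g @^-1` V).
Proof.
move=> hg V hV.
have : [set V | coord_sigma (g @^-1` V)] V.
  apply: hV; split; first split.
  - exact: (@measurable0 _ (g_sigma_algebraType G)).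
  - by move=> A hA; rewrite setTD; exact: (@coord_sigmaC (g @^-1` A)).
  - by move=> F hF /=; rewrite preimage_bigcup; apply: coord_sigma_bigcup.
  - move=> U oU /=; apply: coord_sigma_open => x Ux.
    have : nbhs (g x) U by apply: open_nbhs_nbhs; split.
    move=> /nbhs_ballP[e /= e0 he].
    by have [r r0 hr] := hg x e e0; exists r => // y /hr/he.
by [].

Qed.

Lemma coord_sigma_closed (T : pseudoMetricType R) (g : (I -> R) -> T) :
  (forall x e, 0 < e -> exists2 r : R, 0 < r &
     forall y : I -> R, (forall i, `|y i - x i| < r) -> ball (g x) e (g y)) ->
  forall V, closed V -> coord_sigma (g @^-1` V).
Proof.
move=> hg V cV; rewrite -[V]setCK preimage_setC; apply: coord_sigmaC.
by apply: (@coord_sigma_borel T g hg (~` V)); apply: sub_sigma_algebra; exact: closed_openC.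
Qed.

(** * Lebesgue measure on the unit cube as the image of a probability *)

Section repr.
Context d (W : measurableType d) (Q : probability W R) (phi : W -> I -> R).
Hypothesis mphi : forall i, measurable_fun setT (phi^~ i).
Hypothesis Qbox : forall a b : I -> R, (forall i, 0 <= a i <= b i) -> (forall i, b i <= 1) ->
  Q (phi @^-1` box (a, b)) = box_vol (a, b).
Let cube : set (I -> R) := box (fun=> 0, fun=> 1).

Lemma coord_sigma_measurable A : coord_sigma A -> measurable (phi @^-1` A).
Proof.
move=> hA; have : [set A | measurable (phi @^-1` A)] A.
  apply: hA; split; first split.
  - by rewrite /= preimage_set0.
  - by move=> B hB; rewrite setTD /=; apply: measurableC.
  - by move=> F hF /=; rewrite preimage_bigcup; apply: bigcupT_measurable.
  - move=> _ [i [c ->]] /=.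
    have := mphi i measurableT _ (measurable_itv `]-oo, c[); rewrite setTI.
    by congr measurable; apply/seteqP; split => x /=; rewrite in_itv.
by [].

Qed.

Lemma coord_sigma_box ab : coord_sigma (box ab : set (I -> R)).
Proof.
rewrite (_ : box ab = [set x | forall i, ((fun x : I -> R => x i : R^o) @^-1` `[ab.1 i, ab.2 i]) x]).
  apply: coord_sigma_forall => i; apply: coord_sigma_closed; last exact: itv_closed.
  by move=> x e e0; exists e => // y /(_ i); rewrite -ball_normE /= distrC.
by apply/seteqP; split => x hx i; have := hx i; rewrite /= in_itv.
Qed.

Let Q_cube : Q (phi @^-1` cube) = 1%E.
Proof.
rewrite Qbox; [|by move=> i; rewrite lexx ler01|by []].
by rewrite /box_vol big1// => i _; rewrite /= subr0.
Qed.

Let mcube : measurable (phi @^-1` cube).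
Proof. by apply: coord_sigma_measurable; exact: coord_sigma_box. Qed.

Let Q_box_le ab : (forall i, ab.1 i <= ab.2 i) ->
  (Q (phi @^-1` (box ab `&` cube)) <= box_vol ab)%E.
Proof.
move=> h.
have [/forallP hh|] := boolP [forall i, (ab.1 i <= 1) && (0 <= ab.2 i)]; last first.
  rewrite negb_forall => /existsP[i hi].
  rewrite (_ : _ `&` _ = set0); first by rewrite preimage_set0 measure0 box_vol_ge0.
  apply/seteqP; split => // x [/(_ i) /andP[h1 h2] /(_ i)/= /andP[h3 h4]].
  by move: hi; rewrite (le_trans h1 h4) (le_trans h3 h2).
rewrite (_ : _ `&` _ = box (fun i => Num.max (ab.1 i) 0, fun i => Num.min (ab.2 i) 1)).
  rewrite Qbox; first last.
  - by move=> i; rewrite ge_min lexx orbT.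
  - move=> i; rewrite le_max lexx orbT/= ge_max !le_min h ler01.
    by have /andP[-> ->] := hh i.
  rewrite lee_fin; apply: ler_prod => i _ /=; have /andP[h1 h2] := hh i; apply/andP; split.
    by rewrite subr_ge0 ge_max !le_min h ler01 h1 h2.
  by rewrite lerB// ?ge_min ?le_max lexx.
apply/seteqP; split => x /=.
  move=> [h1 h2] i; have := h1 i; have := h2 i => /= /andP[h3 h4] /andP[h5 h6].
  by rewrite ge_max le_min h3 h4 h5 h6.
move=> h1; split => i; have /= := h1 i; rewrite ge_max le_min.
  by move=> /andP[/andP[-> _] /andP[-> _]].
by move=> /andP[/andP[_ ->] /andP[_ ->]].
Qed.

Let Q_le_leb_outer A : coord_sigma A -> (Q (phi @^-1` A) <= leb_outer A)%E.
Proof.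
move=> cA; apply: le_ereal_inf_tmp => _ [F [cF h AF] <-].
pose S ab := phi @^-1` (box ab `&` cube).
have mS ab : measurable (S ab).
  by apply: coord_sigma_measurable; apply: coord_sigmaI; exact: coord_sigma_box.
have /countable_bijP[B /card_esym/ppcard_eqP[f]] := cF.
pose Gn n := if n \in B then S (f n) else set0.
have mG n : measurable (Gn n) by rewrite /Gn; case: ifP.
have mA := coord_sigma_measurable _ cA.
have Q0 : Q (phi @^-1` A `\` phi @^-1` cube) = 0%E.
  apply/eqP; rewrite eq_le measure_ge0 andbT.
  have <- : Q (~` (phi @^-1` cube)) = 0%E by rewrite probability_setC// Q_cube subee.
  by apply: le_measure => [||x []//]; rewrite inE; [exact: measurableD|exact: measurableC].
rewrite (measureDI Q mA mcube) [X in (X + _)%E](_ : _ = 0%E) ?Q0// add0e.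
apply: (@le_trans _ _ (\sum_(n <oo) Q (Gn n))%E).
  apply: measure_sigma_subadditive => //; first exact: measurableI.
  move=> x [/AF[ab Fab abx] cx]; have [n Bn fn] := @surj _ _ _ _ f _ Fab.
  by exists n => //; rewrite /Gn mem_set// fn.
rewrite nneseries_esumT; last by move=> n; exact: measure_ge0.
rewrite (reindex_esum B F f); last exact: bij.
rewrite [leRHS]esum_mkcond; apply: le_esum => n _; rewrite /Gn.
case: ifPn => [|_]; last by rewrite measure0.
by rewrite inE => Bn; apply/Q_box_le/h/(@funS _ _ _ _ f).
Qed.

(** Covering arguments give only Q <= [leb_outer]. Applied to [A] and to its complement in the cube
    this forces equality, since by the Caratheodory property the two outer measures add up to that
    of the cube, which is at most 1 = Q (cube). *)
Lemma leb_outer_repr A : coord_sigma A -> A `<=` cube -> leb_outer A = Q (phi @^-1` A).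
Proof.
move=> cA AC.
have mA := coord_sigma_measurable _ cA.
have cCA : coord_sigma (cube `&` ~` A).
  by apply: coord_sigmaI; [exact: coord_sigma_box|exact: coord_sigmaC].
apply/eqP; rewrite eq_le Q_le_leb_outer// andbT.
have lo1 : (@leb_outer R I cube <= 1)%E.
  have v1 : @box_vol R I (fun=> 0, fun=> 1) = 1%E.
    by rewrite /box_vol big1// => i _; rewrite /= subr0.
  have := @leb_outer_le R I cube _ [set tt] (fun=> (fun=> 0, fun=> 1)).
  rewrite esum_set1 ?v1// => h; apply: h => //.
  by move=> x hx; exists tt.
have := coord_sigma_caratheodory _ cA cube; rewrite (setIidr AC) => e.
have fQ : Q (phi @^-1` (cube `&` ~` A)) \is a fin_num.
  by apply: fin_num_measure; exact: coord_sigma_measurable.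
rewrite -(leeD2rE _ _ fQ).
apply: (@le_trans _ _ 1%E).
  apply: le_trans lo1; rewrite e; apply: leeD => //; exact: Q_le_leb_outer.
rewrite -Q_cube (measureDI Q mcube mA) addeC.
rewrite (_ : phi @^-1` cube `&` phi @^-1` A = phi @^-1` A) ?leeD//.
by rewrite -preimage_setI (setIidr AC).
Qed.

End repr.
End coord_sigma.

Set Implicit Arguments.
Unset Strict Implicit.
Unset Printing Implicit Defensive.

(** * Expectations and power spaces *)

Section expectation.
Context {R : realType} d (T : measurableType d) (P : probability T R).
Implicit Types (f g : T -> R).

(** Bounded measurable functions are integrable for every probability and stable under all the
    operations below, so expectations can be handled as plain real numbers. *)
Definition bmf f := measurable_fun setT f /\ exists M, forall x, `|f x| <= M.

Definition Ex f : R := (\int[P]_x f x)%R.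

Lemma bmf_integrable f : bmf f -> P.-integrable setT (EFin \o f).
Proof.
move=> [mf [M hM]]; apply: measurable_bounded_integrable => //.
  by rewrite [X in (X < _)%E](@probability_setT _ _ _ P) ltry.
by exists M; split; [exact: num_real|move=> x Mx y _; apply: le_trans (hM y) (ltW Mx)].
Qed.

Lemma Ex_EFin f : bmf f -> (Ex f)%:E = (\int[P]_x (f x)%:E)%E.
Proof. by move=> bf; rewrite /Ex /Rintegral fineK// integrable_fin_num//; exact: bmf_integrable. Qed.

Lemma bmf_cst c : bmf (fun=> c).
Proof. by split => //; exists `|c|. Qed.

Lemma bmfD f g : bmf f -> bmf g -> bmf (fun x => f x + g x).
Proof.
move=> [mf [M hM]] [mg [N hN]]; split; first exact: measurable_funD.
by exists (M + N) => x; apply: (le_trans (ler_normD _ _)); rewrite lerD.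
Qed.

Lemma bmfM f g : bmf f -> bmf g -> bmf (fun x => f x * g x).
Proof.
move=> [mf [M hM]] [mg [N hN]]; split; first exact: measurable_funM.
by exists (M * N) => x; rewrite normrM ler_pM.
Qed.

Lemma bmfN f : bmf f -> bmf (fun x => - f x).
Proof.
move=> [mf [M hM]]; split; first exact: measurableT_comp.
by exists M => x; rewrite normrN.
Qed.

Lemma bmfB f g : bmf f -> bmf g -> bmf (fun x => f x - g x).
Proof. by move=> bf bg; apply: bmfD => //; exact: bmfN. Qed.

Lemma bmf_norm f : bmf f -> bmf (fun x => `|f x|).
Proof.
move=> [mf [M hM]]; split; first exact: measurableT_comp.
by exists M => x; rewrite normr_id.
Qed.

Lemma bmf_sum (I : Type) (r : seq I) (p : pred I) (F : I -> T -> R) :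
  (forall i, p i -> bmf (F i)) -> bmf (fun x => \sum_(i <- r | p i) F i x).
Proof.
move=> h; elim: r => [|i r IH].
  by under eq_fun do rewrite big_nil; exact: bmf_cst.
case pi : (p i).
  rewrite (_ : (fun x => _) = fun x => F i x + \sum_(j <- r | p j) F j x); last first.
    by apply/funext => x; rewrite big_cons pi.
  by apply: bmfD => //; exact: h.
by rewrite (_ : (fun x => _) = fun x => \sum_(j <- r | p j) F j x)//; apply/funext => x; rewrite big_cons pi.
Qed.

Lemma bmf_prod (I : Type) (r : seq I) (p : pred I) (F : I -> T -> R) :
  (forall i, p i -> bmf (F i)) -> bmf (fun x => \prod_(i <- r | p i) F i x).
Proof.
move=> h; elim: r => [|i r IH].
  by under eq_fun do rewrite big_nil; exact: bmf_cst.
case pi : (p i).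
  rewrite (_ : (fun x => _) = fun x => F i x * \prod_(j <- r | p j) F j x); last first.
    by apply/funext => x; rewrite big_cons pi.
  by apply: bmfM => //; exact: h.
by rewrite (_ : (fun x => _) = fun x => \prod_(j <- r | p j) F j x)//; apply/funext => x; rewrite big_cons pi.
Qed.

Lemma bmfX f n : bmf f -> bmf (fun x => f x ^+ n).
Proof.
move=> bf; elim: n => [|n IH].
  by rewrite (_ : (fun x => f x ^+ 0) = fun=> 1); [exact: bmf_cst|apply/funext => x; rewrite expr0].
rewrite (_ : (fun x => f x ^+ n.+1) = fun x => f x * f x ^+ n); first exact: bmfM.
by apply/funext => x; rewrite exprS.
Qed.

Lemma bmf_expR f : bmf f -> bmf (fun x => expR (f x)).
Proof.
move=> [mf [M hM]]; split; first exact: measurableT_comp.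
exists (expR M) => x; rewrite ger0_norm ?expR_ge0// ler_expR.
exact: le_trans (ler_norm _) (hM x).
Qed.

Lemma bmf_indic (A : set T) : measurable A -> bmf (\1_A).
Proof.
by move=> mA; split; [exact: measurable_indic|exists 1 => x; rewrite indicE; case: (_ \in _); rewrite ?normr0 ?normr1].
Qed.

Lemma ExD f g : bmf f -> bmf g -> Ex (fun x => f x + g x) = Ex f + Ex g.
Proof. by move=> bf bg; rewrite /Ex RintegralD//; exact: bmf_integrable. Qed.

Lemma ExZ c f : bmf f -> Ex (fun x => c * f x) = c * Ex f.
Proof. by move=> bf; rewrite /Ex RintegralZl//; exact: bmf_integrable. Qed.

Lemma ExZr c f : bmf f -> Ex (fun x => f x * c) = Ex f * c.
Proof. by move=> bf; rewrite /Ex RintegralZr//; exact: bmf_integrable. Qed.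

Lemma ExB f g : bmf f -> bmf g -> Ex (fun x => f x - g x) = Ex f - Ex g.
Proof. by move=> bf bg; rewrite /Ex RintegralB//; exact: bmf_integrable. Qed.

Lemma Ex_cst c : Ex (fun=> c) = c.
Proof.
rewrite /Ex Rintegral_cst// -[RHS]mulr1; congr (_ * _).
exact: (congr1 fine (probability_setT P)).
Qed.

Lemma Ex_sum (I : Type) (r : seq I) (p : pred I) (F : I -> T -> R) :
  (forall i, p i -> bmf (F i)) ->
  Ex (fun x => \sum_(i <- r | p i) F i x) = \sum_(i <- r | p i) Ex (F i).
Proof.
move=> h; elim: r => [|i r IH].
  by under eq_fun do rewrite big_nil; rewrite Ex_cst big_nil.
rewrite big_cons; case pi : (p i); last first.
  by rewrite -IH; congr Ex; apply/funext => x; rewrite big_cons pi.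
rewrite -IH -ExD; [|exact: h|exact: bmf_sum].
by congr Ex; apply/funext => x; rewrite big_cons pi.
Qed.

Lemma Ex_le f g : bmf f -> bmf g -> (forall x, f x <= g x) -> Ex f <= Ex g.
Proof. by move=> bf bg fg; apply: le_Rintegral => //; exact: bmf_integrable. Qed.

Lemma Ex_ge0 f : (forall x, 0 <= f x) -> 0 <= Ex f.
Proof. by move=> f0; apply: Rintegral_ge0. Qed.

Lemma Ex_indic (A : set T) : measurable A -> (Ex (\1_A))%:E = P A.
Proof. by move=> mA; rewrite Ex_EFin ?integral_indic ?setIT//; exact: bmf_indic. Qed.

End expectation.

Lemma bmf_comp {R : realType} d d' (T : measurableType d) (T' : measurableType d')
  (h : T -> T') (f : T' -> R) : measurable_fun setT h -> bmf f -> bmf (f \o h).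
Proof.
by move=> mh [mf [M hM]]; split; [exact: measurableT_comp|exists M => x; exact: hM].
Qed.

Definition pprod {R : realType} d1 d2 (T1 : measurableType d1) (T2 : measurableType d2)
    (P1 : probability T1 R) (P2 : probability T2 R) : probability (T1 * T2)%type R :=
  (P1 \x P2)%E.

Section product.
Context {R : realType} d1 d2 (T1 : measurableType d1) (T2 : measurableType d2)
  (P1 : probability T1 R) (P2 : probability T2 R).

Lemma Ex_product (f : T1 -> R) (g : T2 -> R) : bmf f -> bmf g ->
  Ex (pprod P1 P2) (fun x => f x.1 * g x.2) = Ex P1 f * Ex P2 g.
Proof.
move=> bf bg.
have bfg : bmf (fun x : T1 * T2 => f x.1 * g x.2).
  by apply: bmfM; [exact: (bmf_comp measurable_fst)|exact: (bmf_comp measurable_snd)].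
apply: EFin_inj; rewrite Ex_EFin//.
rewrite -(@integral12_prod_meas1 _ _ _ _ _ P1 P2 (fun x => (f x.1 * g x.2)%:E)); last first.
  exact: (bmf_integrable (pprod P1 P2)).
rewrite (_ : Ex P1 f * Ex P2 g = Ex P1 (fun x => f x * Ex P2 g)); last by rewrite ExZr.
rewrite Ex_EFin; last by apply: bmfM => //; exact: bmf_cst.
apply: eq_integral => x _ /=.
by rewrite -ExZ// Ex_EFin//; apply: bmfM => //; exact: bmf_cst.
Qed.

End product.

Section power.
Context {R : realType} d (T : measurableType d) (P : probability T R).

Definition consp n (x : T * n.-tuple T) : n.+1.-tuple T := [tuple of x.1 :: x.2].

Lemma measurable_consp n : measurable_fun setT (@consp n).
Proof. exact: measurable_cons. Qed.

HB.instance Definition _ n := isMeasurableFun.Build _ _ _ _ (@consp n) (@measurable_consp n).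

(** The law of n independent draws, built on pairs so that independence comes from [Ex_product].
    Nested three times, it describes groups of blocks of coordinates. *)
Fixpoint pw n : probability (n.-tuple T) R :=
  if n is n'.+1 then distribution (pprod P (pw n')) (@consp n') else dirac [tuple].

Lemma bmf_tnth n (i : 'I_n) (f : T -> R) : bmf f -> bmf (fun x : n.-tuple T => f (tnth x i)).
Proof. by move=> bf; apply: (@bmf_comp _ _ _ _ _ (fun x : n.-tuple T => tnth x i)) => //; exact: measurable_tnth. Qed.

Lemma Ex_pw_cons n (h : n.+1.-tuple T -> R) (f : T -> R) (g : n.-tuple T -> R) :
  bmf h -> bmf f -> bmf g -> (forall x y, h (consp (x, y)) = f x * g y) ->
  Ex (pw n.+1) h = Ex P f * Ex (pw n) g.
Proof.
move=> bh bf bg hE; rewrite -Ex_product//.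
have bhc : bmf (h \o @consp n) by apply: bmf_comp => //; exact: measurable_consp.
apply: EFin_inj; rewrite Ex_EFin// [RHS]Ex_EFin; last first.
  by apply: bmfM; [exact: (bmf_comp measurable_fst)|exact: (bmf_comp measurable_snd)].
rewrite [LHS](@integral_distribution _ _ _ _ _ (pprod P (pw n)) (@consp n) (EFin \o h)).
- by apply: eq_integral => -[x y] _ /=; rewrite -hE.
- by apply/measurable_EFinP; case: bh.
- exact: (bmf_integrable (pprod P (pw n))).
Qed.

Lemma Ex_pw_prod n (f : 'I_n -> T -> R) : (forall i, bmf (f i)) ->
  Ex (pw n) (fun x => \prod_i f i (tnth x i)) = \prod_i Ex P (f i).
Proof.
elim: n f => [|n IH] f bf.
  rewrite big_ord0 (_ : (fun x => _) = fun=> 1) ?Ex_cst//.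
  by apply/funext => x; rewrite big_ord0.
rewrite big_ord_recl -IH => [|i]; last exact: bf.
apply: Ex_pw_cons => //.
- by apply: bmf_prod => i _; exact: bmf_tnth.
- by apply: bmf_prod => i _; exact: bmf_tnth.
- move=> x y; rewrite big_ord_recl; congr (_ * _).
  by apply: eq_bigr => i _; rewrite tnthS.
Qed.

End power.

(** * The uniform law *)

Section uniform01.
Context {R : realType}.

(** [U01] is a law on all of R; clamping puts coordinates in [0, 1] at every outcome instead of
    almost surely, without changing the law. *)
Definition clamp (x : R) : R := Num.min (Num.max x 0) 1.

Lemma clamp_ge0 x : 0 <= clamp x.
Proof. by rewrite /clamp le_min ler01 le_max lexx orbT. Qed.

Lemma clamp_le1 x : clamp x <= 1.
Proof. by rewrite /clamp ge_min lexx orbT. Qed.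

Lemma clampK x : 0 <= x <= 1 -> clamp x = x.
Proof. by move=> /andP[x0 x1]; rewrite /clamp max_l// min_l. Qed.

Lemma measurable_clamp : measurable_fun setT clamp.
Proof. by apply: measurable_minr => //; apply: measurable_maxr. Qed.

Definition U01 : probability (measurableTypeR R) R := uniform_prob (@ltr01 R).

Lemma bmf_clamp : bmf clamp.
Proof.
split; first exact: measurable_clamp.
by exists 1 => x; rewrite ger0_norm ?clamp_ge0// clamp_le1.
Qed.

Lemma bmf_expR_clamp c : bmf (fun x => expR (c * clamp x)).
Proof. by apply: bmf_expR; apply: bmfM; [exact: bmf_cst|exact: bmf_clamp]. Qed.

Lemma Ex_U01 (f : R -> R) : measurable_fun setT f -> (forall x, 0 <= x <= 1 -> 0 <= f x) ->
  (exists M, forall x, 0 <= x <= 1 -> f x <= M) ->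
  (Ex U01 (f \o clamp))%:E = (\int[lebesgue_measure]_(x in `[0%R, 1%R]) (f x)%:E)%E.
Proof.
move=> mf f0 [M fM].
have c01 x : 0 <= clamp x <= 1 by rewrite clamp_ge0 clamp_le1.
rewrite Ex_EFin; last first.
  split; first exact: measurableT_comp measurable_clamp.
  by exists M => x /=; rewrite ger0_norm ?f0 ?fM.
rewrite integral_uniform//; last first.
- by move=> x /=; rewrite lee_fin f0.
- by apply/measurable_EFinP; exact: measurableT_comp measurable_clamp.
rewrite subr0 invr1 mul1e; apply: eq_integral => x.
by rewrite inE/= in_itv/= => /clampK ->.
Qed.

Lemma Ex_expR_clamp (c : R) : 0 < c ->
  Ex U01 (fun x => expR (- c * clamp x)) = (1 - expR (- c)) / c.
Proof.
move=> c0; apply: EFin_inj.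
rewrite (@Ex_U01 (fun x => expR (- c * x))); first last.
- exists 1 => x /andP[x0 _]; rewrite expR_le1; nra.
- by move=> x _; exact: expR_ge0.
- by apply: measurableT_comp => //; exact: measurable_funM.
have dF (x : R) : is_derive x (1 : R) (fun x : R => - (expR (- c * x)) / c : R) (expR (- c * x)).
  have h : is_derive x (1 : R) (fun x : R => - c * x : R) (- c).
    by apply: is_derive_eq; exact: mulr1.
  have h2 : is_derive x (1 : R) (fun x : R => expR (- c * x) : R) (expR (- c * x) * - c).
    exact: (is_derive1_comp (is_derive_expR _) h).
  have h3 : is_derive x (1 : R) (fun x : R => - expR (- c * x) : R) (- (expR (- c * x) * - c)).
    exact: is_deriveN.
  rewrite (_ : (fun x : R => _) = (fun x : R => c^-1 *: (- expR (- c * x) : R^o) : R)).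
    apply: is_derive_eq; rewrite /GRing.scale /=; field; exact: lt0r_neq0.
  by apply/funext => y; rewrite /GRing.scale /= mulrC.
have cF (x : R) : {for x, continuous (fun x : R => - (expR (- c * x)) / c : R)}.
  apply: differentiable_continuous; apply/derivable1_diffP.
  by have [] := dF x.
rewrite (@continuous_FTC2 _ _ (fun x => - (expR (- c * x)) / c))//.
- rewrite -EFinB mulr0 mulr1 expR0; congr EFin; field; exact: lt0r_neq0.
- apply: continuous_subspaceT => x; apply: continuous_comp; last exact: continuous_expR.
  apply: mulrl_continuous.
- split.
  + by move=> x _; have [] := dF x.
  + exact/cvg_at_right_filter/cF.
  + exact/cvg_at_left_filter/cF.
- by move=> x _; rewrite derive1E; have [_] := dF x.
Qed.

Lemma Ex_clamp_itv (a b : R) : 0 <= a <= b -> b <= 1 ->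
  Ex U01 (fun x => (a <= clamp x <= b)%R%:R) = b - a.
Proof.
move=> /andP[a0 ab] b1; apply: EFin_inj.
have mab : measurable_fun setT (fun x : R => (a <= x <= b)%R%:R : R).
  rewrite (_ : (fun x => _) = \1_`[a, b]); first exact: measurable_indic.
  by apply/funext => x; rewrite indicE mem_setE in_itv.
rewrite (@Ex_U01 (fun x => (a <= x <= b)%R%:R))//.
- rewrite (eq_integral (fun x : measurableTypeR R => (\1_(`[a, b]%classic : set (measurableTypeR R)) x)%:E)); last first.
    by move=> x _; rewrite indicE mem_setE in_itv.
  rewrite integral_indic//= (_ : _ `&` _ = `[a, b]%classic).
    by rewrite lebesgue_measure_itv/= lte_fin; case: ltgtP ab => // -> _; rewrite subrr.
  apply/setIidl => x /=; rewrite !in_itv/= => /andP[xa xb].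
  by rewrite (le_trans a0 xa) (le_trans xb b1).
- by exists 1 => x _; case: (_ && _).
Qed.

Definition y0 : R := 1 - expR (- 1).
Definition b0 : R := 2 * (1 - expR (- 2^-1)).

Lemma Ex_y0 : Ex U01 (fun x => expR (- clamp x)) = y0.
Proof.
rewrite /y0 -[RHS]divr1 -Ex_expR_clamp //.
by congr Ex; apply/funext => x; rewrite mulN1r.
Qed.

Lemma Ex_b0 : Ex U01 (fun x => expR (- (clamp x / 2))) = b0.
Proof.
rewrite (_ : b0 = (1 - expR (- 2^-1)) / 2^-1); last by rewrite /b0 invrK mulrC.
rewrite -Ex_expR_clamp ?invr_gt0//.
by congr Ex; apply/funext => x; congr expR; rewrite mulNr mulrC.
Qed.

(** Makes (2 y0)^-T small, which pays for truncating thresholds at 2^-(T #|J|), and gives y0^-2 < 4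
    for the relative variance of block means. *)
Lemma y0_gt_half : 2^-1 < y0.
Proof.
rewrite /y0 expRN; have : 2 < expR 1 :> R by apply: expR_gt1Dx; exact: oner_neq0.
move=> h; have : (expR 1)^-1 < 2^-1 :> R by rewrite ltf_pV2 ?posrE ?expR_gt0.
lra.
Qed.

(* With r = e^(-1/2), this is 4 (1 - r)^2 < 1 - r^2, i.e. r > 3/5. *)
Lemma b0_sqr_lt_y0 : b0 ^+ 2 < y0.
Proof.
rewrite /b0 /y0; set r : R := expR (- 2^-1).
have -> : expR (- 1) = r ^+ 2 by rewrite /r -expRM_natl; congr expR; field.
have r1 : r < 1 by rewrite expR_lt1; lra.
suff : 3 / 5 < r by nra.
(* The bound e^-x >= 1 - x is too weak at x = 1/2, so it is used at 1/32 and squared four times. *)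
have -> : r = expR (- 32^-1) ^+ 16 by rewrite /r -expRM_natl; congr expR; field.
have h : 31 / 32 <= expR (- 32^-1) :> R by apply: le_trans (expR_ge1Dx _); lra.
have h2 : 961 / 1024 <= expR (- 32^-1) ^+ 2 :> R by nra.
have h4 : 8807 / 10000 <= expR (- 32^-1) ^+ 4 :> R by rewrite (exprM _ 2 2); nra.
have h8 : 7756 / 10000 <= expR (- 32^-1) ^+ 8 :> R by rewrite (exprM _ 4 2); nra.
by rewrite (exprM _ 8 2); nra.
Qed.

End uniform01.

(** * Poisson families of cuts *)

Lemma prod_natr_bool (R : realType) (I : finType) (b : I -> bool) :
  \prod_i (b i)%:R = [forall i, b i]%:R :> R.
Proof.
have [/forallP h|] := boolP [forall i, b i].
  by rewrite big1// => i _; rewrite h.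
by rewrite negb_forall => /existsP[i /negPf bi]; rewrite (bigD1 i)//= bi mul0r.
Qed.

Lemma tnth_behead_lift (T : Type) n (X : n.+1.-tuple T) (i : 'I_n) :
  tnth [tuple of behead X] i = tnth X (lift ord0 i).
Proof. by case/tupleP: X => x X; rewrite tnthS; congr tnth; apply: val_inj. Qed.

Section random_cuts.
Context {R : realType} d (E : measurableType d) (P : probability E R).
Context (S : finType) (c : S -> E -> bool) (lam : S -> R).
Hypothesis mc : forall s, bmf (fun x => (c s x)%:R : R).
Hypothesis lam0 : forall s, 0 <= lam s.
Implicit Types (w : {ffun S -> bool}).

Definition pbit (s : S) (b : bool) : R := if b then 1 - expR (- lam s) else expR (- lam s).
Definition pb w : R := \prod_s pbit s (w s).
Definition kept w x := [forall s, w s ==> ~~ c s x].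
Definition kvol w : R := Ex P (fun x => (kept w x)%:R).
Definition mom j : R := \sum_w pb w * kvol w ^+ j.
Definition rate x : R := \sum_s lam s * (c s x)%:R.
(** The probability that no cut of the random family hits any point of [X]; see [gapE]. *)
Definition gap n (X : n.-tuple E) : R :=
  expR (- \sum_s lam s * [exists i, c s (tnth X i)]%:R).
(** The mean total rate of the cuts that hit both of two independent points. *)
Definition pairs : R := \sum_s lam s * Ex P (fun x => (c s x)%:R) ^+ 2.
Definition free : R := Ex P (fun x => expR (- rate x)).

Lemma pbit_ge0 s b : 0 <= pbit s b.
Proof.
rewrite /pbit; case: b; last exact: expR_ge0.
by rewrite subr_ge0 expR_le1 oppr_le0.
Qed.

Lemma pb_ge0 w : 0 <= pb w.
Proof. by apply: prodr_ge0 => s _; exact: pbit_ge0. Qed.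

(* Thinning of a Poisson process: a cut s is absent with probability e^(-lam s). *)
Lemma sum_pb_avoid (h : S -> bool) :
  \sum_w pb w * [forall s, w s ==> ~~ h s]%:R = expR (- \sum_s lam s * (h s)%:R).
Proof.
transitivity (\prod_s \sum_b pbit s b * (b ==> ~~ h s)%:R).
  rewrite bigA_distr_bigA/=; apply: eq_bigr => w _.
  by rewrite -prod_natr_bool -big_split.
rewrite -sumrN expR_sum; apply: eq_bigr => s _.
rewrite big_bool /pbit/=; case: (h s) => /=; rewrite ?mulr0 ?mulr1 ?add0r//.
by rewrite oppr0 expR0 subrK.
Qed.

Lemma sum_pb : \sum_w pb w = 1.
Proof.
transitivity (expR (- \sum_s lam s * (false : nat)%:R)); last first.
  by rewrite big1 ?oppr0 ?expR0// => s _; rewrite mulr0.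
rewrite -(sum_pb_avoid (fun=> false)); apply: eq_bigr => w _; rewrite (_ : [forall s, _] = true) ?mulr1//.
by apply/forallP => s; rewrite implybT.
Qed.

Lemma mkept w : bmf (fun x => (kept w x)%:R : R).
Proof.
rewrite (_ : (fun x => _) = fun x => \prod_s (if w s then 1 - (c s x)%:R else 1)).
  apply: bmf_prod => s _; case: (w s); last exact: bmf_cst.
  by apply: bmfB => //; exact: bmf_cst.
apply/funext => x; rewrite -prod_natr_bool; apply: eq_bigr => s _.
by case: (w s) => //=; case: (c s x); rewrite ?subrr ?subr0.
Qed.

Lemma kvol_ge0 w : 0 <= kvol w.
Proof. by apply: Ex_ge0 => x; exact: ler0n. Qed.

Lemma gapE n (X : n.-tuple E) : gap X = \sum_w pb w * \prod_i (kept w (tnth X i))%:R.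
Proof.
rewrite /gap -sum_pb_avoid; apply: eq_bigr => w _; congr (_ * _).
rewrite prod_natr_bool; congr ((_ : bool)%:R); apply/forallP/forallP => h.
  move=> i; apply/forallP => s; apply/implyP => ws.
  by have /implyP/(_ ws) := h s; rewrite negb_exists => /forallP.
move=> s; apply/implyP => ws; rewrite negb_exists; apply/forallP => i.
by have /forallP/(_ s)/implyP/(_ ws) := h i.
Qed.

Lemma bmf_kept_prod n w : bmf (fun X : n.-tuple E => \prod_i (kept w (tnth X i))%:R : R).
Proof. by apply: bmf_prod => i _; apply: (@bmf_tnth _ _ _ _ _ (fun x => (kept w x)%:R)); exact: mkept. Qed.

Lemma bmf_gap n : bmf (@gap n).
Proof.
rewrite (_ : @gap n = fun X => \sum_w pb w * \prod_i (kept w (tnth X i))%:R).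
  by apply: bmf_sum => w _; apply: bmfM; [exact: bmf_cst|exact: bmf_kept_prod].
by apply/funext => X; exact: gapE.
Qed.

Lemma bmf_rate : bmf rate.
Proof. by apply: bmf_sum => s _; apply: bmfM => //; exact: bmf_cst. Qed.

Lemma bmf_expN_rate : bmf (fun x => expR (- rate x)).
Proof. by apply/bmf_expR/bmfN/bmf_rate. Qed.

(** For a fixed family, the n-th power of the volume is the probability that n independent points
    are all kept; then the two averages are exchanged. *)
Lemma momE n : mom n = Ex (pw P n) (@gap n).
Proof.
rewrite (_ : @gap n = fun X => \sum_w pb w * \prod_i (kept w (tnth X i))%:R); last first.
  by apply/funext => X; exact: gapE.
rewrite Ex_sum; last by move=> w _; apply: bmfM; [exact: bmf_cst|exact: bmf_kept_prod].
apply: eq_bigr => w _; rewrite ExZ; last exact: bmf_kept_prod.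
rewrite (@Ex_pw_prod _ _ _ P n (fun _ x => (kept w x)%:R)) => [|i]; last exact: mkept.
by rewrite prodr_const card_ord.
Qed.

Lemma mom0 : mom 0 = 1.
Proof. by rewrite -sum_pb; apply: eq_bigr => w _; rewrite expr0 mulr1. Qed.

Lemma mom_ge0 n : 0 <= mom n.
Proof. by apply: sumr_ge0 => w _; rewrite mulr_ge0 ?pb_ge0// exprn_ge0// kvol_ge0. Qed.

Lemma mom1 : mom 1 = free.
Proof.
rewrite /free (_ : (fun x => _) = fun x => \sum_w pb w * (kept w x)%:R).
  rewrite Ex_sum => [|w _]; last by apply: bmfM; [exact: bmf_cst|exact: mkept].
  by apply: eq_bigr => w _; rewrite ExZ//; exact: mkept.
by apply/funext => x; rewrite /kept sum_pb_avoid.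
Qed.

(** A cut hitting several points is counted once on the right, but once per point on the left. *)
Lemma gap_ge_prod n (X : n.-tuple E) : \prod_i expR (- rate (tnth X i)) <= gap X.
Proof.
rewrite -expR_sum ler_expR sumrN lerN2 /rate exchange_big/=.
apply: ler_sum => s _; rewrite -mulr_sumr; apply: ler_wpM2l => //.
have [/existsP[i ci]|_] := boolP [exists i, c s (tnth X i)]; last by apply: sumr_ge0 => i _; exact: ler0n.
by rewrite (bigD1 i)//= ci lerDl sumr_ge0// => j _; exact: ler0n.
Qed.

Definition overlap n (X : n.-tuple E) y : R :=
  \sum_(i < n) \sum_s lam s * (c s (tnth X i))%:R * (c s y)%:R.

Lemma overlap_ge0 n (X : n.-tuple E) y : 0 <= overlap X y.
Proof. by apply: sumr_ge0 => i _; apply: sumr_ge0 => s _; rewrite !mulr_ge0. Qed.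

(* When the overlap exceeds [e] the trivial bound [gap (y :: X) <= gap X] is used. *)
Lemma gap_cons n (X : n.-tuple E) y (e : R) : 0 < e ->
  gap (consp (y, X)) <= gap X * (expR e * expR (- rate y) + e^-1 * overlap X y).
Proof.
move=> e0.
have exE s : [exists i, c s (tnth (consp (y, X)) i)] = c s y || [exists i, c s (tnth X i)].
  apply/existsP/orP => [[i]|].
    by have [j ->|->] := unliftP ord0 i; [rewrite tnthS => ?; right; apply/existsP; exists j|left].
  by move=> [cy|/existsP[i ci]]; [exists ord0|exists (lift ord0 i); rewrite tnthS].
have G0 : 0 <= gap X by exact: expR_ge0.
have [ov|ov] := leP (overlap X y) e.
  apply: (@le_trans _ _ (gap X * (expR e * expR (- rate y)))); last first.
    by rewrite ler_wpM2l// lerDl mulr_ge0 ?overlap_ge0// invr_ge0 ltW.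
  rewrite /gap -!expRD ler_expR.
  suff : \sum_s lam s * [exists i, c s (tnth X i)]%:R + rate y - overlap X y <=
    \sum_s lam s * [exists i, c s (tnth (consp (y, X)) i)]%:R by lra.
  rewrite /rate /overlap exchange_big -sumrN -!big_split/=; apply: ler_sum => s _.
  rewrite exE; case cy : (c s y) => /=; last first.
    by rewrite mulr0 addr0 big1 ?subr0// => i _; rewrite mulr0.
  have [/existsP[i ci]|_] := boolP [exists i, c s (tnth X i)] => /=; last first.
    rewrite mulr0 add0r gerBl sumr_ge0// => i _; rewrite !mulr_ge0//.
  rewrite mulr1 -addrA gerDl subr_le0 (bigD1 i)//= ci !mulr1 lerDl sumr_ge0// => j _.
  by rewrite !mulr_ge0.
apply: (@le_trans _ _ (gap X)).
  rewrite /gap ler_expR lerN2; apply: ler_sum => s _; rewrite ler_wpM2l// exE ler_nat.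
  by case: (c s y); case: [exists _, _].
rewrite -[leLHS]mulr1 ler_wpM2l//.
rewrite -[leLHS]add0r lerD ?mulr_ge0 ?expR_ge0//.
by rewrite mulrC ler_pdivlMr// mul1r ltW.
Qed.

(** This integrates [gap_cons] over a fresh point and n + 1 old ones. In the overlap term with the
    j-th old point, forgetting that this point must survive decouples everything: the two hits give
    a squared expectation, the other n points a power of the volume. *)
Lemma mom_rec n (e : R) : 0 < e ->
  mom n.+2 <= expR e * free * mom n.+1 + e^-1 * n.+1%:R * pairs * mom n.
Proof.
move=> e0; rewrite [mom n.+2]momE.
(* [f1] and [f2] write both terms as products over the n + 2 points, index 0 being the fresh one, so
   that [Ex_pw_prod] applies. *)
pose f1 w (i : 'I_n.+2) : E -> R := if unlift ord0 i is Some _ then fun x => (kept w x)%:R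
   else fun x => expR (- rate x).
pose f2 w (j : 'I_n.+1) s (i : 'I_n.+2) : E -> R := if unlift ord0 i is Some k then
   (if k == j then fun x => (kept w x)%:R * (c s x)%:R else fun x => (kept w x)%:R)
   else fun x => (c s x)%:R.
have bf1 w i : bmf (f1 w i).
  by rewrite /f1; case: unlift => [_|]; [exact: mkept|exact: bmf_expN_rate].
have bf2 w j s i : bmf (f2 w j s i).
  rewrite /f2; case: unlift => [k|//]; case: ifP => _; last exact: mkept.
  by apply: bmfM => //; exact: mkept.
pose h (X : n.+2.-tuple E) : R := \sum_w pb w * (expR e * \prod_i f1 w i (tnth X i) +
   e^-1 * \sum_(j < n.+1) \sum_s lam s * \prod_i f2 w j s i (tnth X i)).
have bp (f : 'I_n.+2 -> E -> R) : (forall i, bmf (f i)) ->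
    bmf (fun X : n.+2.-tuple E => \prod_i f i (tnth X i)).
  by move=> bf; apply: bmf_prod => i _; exact: bmf_tnth.
have bcp a (f : 'I_n.+2 -> E -> R) : (forall i, bmf (f i)) ->
    bmf (fun X : n.+2.-tuple E => a * \prod_i f i (tnth X i)).
  by move=> bf; apply: bmfM; [exact: bmf_cst|exact: bp].
have bss w : bmf (fun X : n.+2.-tuple E => \sum_(j < n.+1) \sum_s lam s * \prod_i f2 w j s i (tnth X i)).
  by apply: bmf_sum => j _; apply: bmf_sum => s _; exact: bcp.
have bess w : bmf (fun X : n.+2.-tuple E => e^-1 * \sum_(j < n.+1) \sum_s lam s * \prod_i f2 w j s i (tnth X i)).
  by apply: bmfM; [exact: bmf_cst|].
have bh : bmf h.
  by apply: bmf_sum => w _; apply: bmfM; [exact: bmf_cst|apply: bmfD => //; exact: bcp].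
apply: (@le_trans _ _ (Ex (pw P n.+2) h)).
  apply: Ex_le => //; first exact: bmf_gap.
  move=> X; rewrite [X in gap X](_ : X = consp (thead X, [tuple of behead X])); last exact: tuple_eta.
  apply: (le_trans (gap_cons _ _ e0)).
  rewrite gapE mulr_suml le_eqVlt; apply/orP; left; apply/eqP/eq_bigr => w _.
  rewrite -mulrA mulrDr; congr (_ * (_ + _)).
    rewrite mulrCA; congr (_ * _); rewrite [RHS]big_ord_recl mulrC; congr (_ * _).
      by rewrite /f1 unlift_none.
    by apply: eq_bigr => i _; rewrite /f1 liftK tnth_behead_lift.
  rewrite mulrCA; congr (_ * _); rewrite /overlap mulr_sumr; apply: eq_bigr => j _.
  rewrite mulr_sumr; apply: eq_bigr => s _.
  rewrite [in RHS]big_ord_recl {1}/f2 unlift_none.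
  rewrite [X in _ = _ * (_ * X)](_ : _ = (\prod_(i < n.+1) (kept w (tnth [tuple of behead X] i))%:R) * (c s (tnth [tuple of behead X] j))%:R).
    by ring.
  rewrite (bigD1 j)//= [in RHS](bigD1 j)//=.
  rewrite {1}/f2 liftK eqxx tnth_behead_lift -!mulrA; congr (_ * _).
  rewrite mulrC; congr (_ * _); apply: eq_bigr => i ij.
  by rewrite /f2 liftK (negPf ij) tnth_behead_lift.
rewrite Ex_sum; last first.
  by move=> w _; apply: bmfM; [exact: bmf_cst|apply: bmfD => //; exact: bcp].
rewrite [leRHS](_ : _ = \sum_w pb w * (expR e * free * kvol w ^+ n.+1 + e^-1 * n.+1%:R * pairs * kvol w ^+ n)); last first.
  rewrite /mom !mulr_sumr -big_split/=; apply: eq_bigr => w _; ring.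
apply: ler_sum => w _; rewrite ExZ; last by apply: bmfD => //; exact: bcp.
rewrite ler_wpM2l ?pb_ge0// ExD//; last exact: bcp.
rewrite ExZ; last exact: bp.
rewrite Ex_pw_prod// ExZ// big_ord_recl.
rewrite (eq_bigr (fun=> kvol w)); last by move=> i _; rewrite /f1 liftK.
rewrite {1}/f1 unlift_none prodr_const card_ord mulrA lerD2l -!mulrA ler_wpM2l ?invr_ge0 ?(ltW e0)//.
rewrite Ex_sum; last by move=> j _; apply: bmf_sum => s _; exact: bcp.
rewrite (_ : n.+1%:R * _ = \sum_(j < n.+1) pairs * kvol w ^+ n); last first.
  by rewrite sumr_const card_ord mulr_natl.
apply: ler_sum => j _; rewrite Ex_sum => [|s _]; last exact: bcp.
rewrite /pairs mulr_suml; apply: ler_sum => s _.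
rewrite ExZ; last exact: bp.
rewrite -mulrA ler_wpM2l// Ex_pw_prod// big_ord_recl {1}/f2 unlift_none expr2 -mulrA.
rewrite ler_wpM2l; [by []|by apply: Ex_ge0 => x; exact: ler0n|].
rewrite (bigD1 j)//= {1}/f2 liftK eqxx.
rewrite (eq_bigr (fun=> kvol w)); last by move=> i ij; rewrite /f2 liftK (negPf ij).
rewrite prodr_const cardC1 card_ord/= ler_wpM2r ?exprn_ge0 ?kvol_ge0//.
apply: Ex_le => // [|x]; first by apply: bmfM => //; exact: mkept.
by case: (kept w x); rewrite ?mul1r// mul0r.
Qed.

(** Chebyshev's association inequality: V^n - v^n and V - v have the same sign, so their product has
    nonnegative mean. *)
Lemma mom_mul_le (v : R) n : 0 <= v -> v <= mom 1 -> v * mom n <= mom n.+1.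
Proof.
move=> v0 v1.
have : 0 <= \sum_w pb w * ((kvol w ^+ n - v ^+ n) * (kvol w - v)).
  apply: sumr_ge0 => w _; rewrite mulr_ge0 ?pb_ge0//.
  have [vw|/ltW wv] := leP v (kvol w).
    by rewrite mulr_ge0 ?subr_ge0// lerXn2r// nnegrE// kvol_ge0.
  by rewrite mulr_le0 ?subr_le0// lerXn2r// nnegrE// kvol_ge0.
rewrite (_ : \sum_w _ = mom n.+1 - v * mom n - v ^+ n * (mom 1 - v)).
  have h : 0 <= v ^+ n * (mom 1 - v) by rewrite mulr_ge0 ?exprn_ge0 ?subr_ge0.
  by move=> h2; rewrite -subr_ge0; apply: le_trans h2 _; rewrite gerBl.
have -> : v ^+ n * (mom 1 - v) = \sum_w pb w * (v ^+ n * (kvol w - v)).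
  rewrite -[X in mom 1 - X]mulr1 -[X in _ - _ * X]sum_pb /mom mulr_sumr -sumrB mulr_sumr.
  by apply: eq_bigr => w _; rewrite expr1; ring.
rewrite /mom mulr_sumr -!sumrB; apply: eq_bigr => w _.
rewrite exprS; ring.
Qed.

Lemma mom_ge (v : R) n : 0 <= v -> v <= mom 1 -> v ^+ n <= mom n.
Proof.
move=> v0 v1; elim: n => [|n IH]; first by rewrite expr0 mom0.
by apply: le_trans (mom_mul_le n v0 v1); rewrite exprS ler_wpM2l.
Qed.

Lemma pairs_ge0 : 0 <= pairs.
Proof. by apply: sumr_ge0 => s _; rewrite mulr_ge0// sqr_ge0. Qed.

Lemma free_ge0 : 0 <= free.
Proof. by apply: Ex_ge0 => x; exact: expR_ge0. Qed.

(** Bounding [mom n] by [mom n.+1 / v] turns the two-step recursion [mom_rec] into a one-step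
    recursion of ratio at most [B]. *)
Lemma mom_le (v e B : R) N n : 0 < v -> v <= free -> 0 < e ->
  expR e * free + e^-1 * N%:R * pairs / v <= B -> (n <= N)%N -> mom n <= B ^+ n.
Proof.
move=> v0 vf e0 hB.
have fB : free <= B.
  apply: le_trans hB; rewrite -[leLHS]addr0 lerD//; last first.
    by rewrite !mulr_ge0 ?invr_ge0 ?pairs_ge0 ?(ltW e0) ?(ltW v0).
  by apply: ler_peMl; [exact: free_ge0|rewrite -expR0 ler_expR ltW].
have B0 : 0 <= B by apply: le_trans fB; exact: free_ge0.
case: n => [|n]; first by rewrite mom0 expr0.
elim: n => [|n IH] hn; first by rewrite mom1 expr1.
apply: (le_trans (mom_rec n e0)).
have h1 : mom n <= mom n.+1 / v.
  by rewrite ler_pdivlMr// mulrC mom_mul_le ?mom1 ?(ltW v0).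
apply: (@le_trans _ _ (B * mom n.+1)); last first.
  by rewrite [leRHS]exprS ler_wpM2l// IH// ltnW.
apply: (@le_trans _ _ ((expR e * free + e^-1 * N%:R * pairs / v) * mom n.+1)); last first.
  by rewrite ler_wpM2r// mom_ge0.
rewrite mulrDl lerD2l -[leRHS]mulrA [v^-1 * _]mulrC; apply: ler_pM => //.
- by rewrite !mulr_ge0 ?invr_ge0 ?pairs_ge0 ?(ltW e0).
- exact: mom_ge0.
- rewrite ler_wpM2r ?pairs_ge0// ler_wpM2l ?invr_ge0 ?(ltW e0)// ler_nat.
  by apply: leq_trans hn; rewrite ltnW.
Qed.

End random_cuts.

Lemma Ex_pw_expn (R : realType) d (T : measurableType d) (P : probability T R) n (f : T -> R) :
  bmf f -> Ex (pw P n) (fun x => \prod_i f (tnth x i)) = Ex P f ^+ n.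
Proof.
move=> bf; rewrite -[n in RHS]card_ord -prodr_const.
exact: (@Ex_pw_prod _ _ _ P n (fun=> f) (fun=> bf)).
Qed.

(** * Concentration of the volume and transfer of the test to a product law *)

Section tilted.
Context {R : realType} d (E : measurableType d) (P : probability E R).
Context (S : finType) (c : S -> E -> bool) (lam : S -> R).
Hypothesis mc : forall s, bmf (fun x => (c s x)%:R : R).
Hypothesis lam0 : forall s, 0 <= lam s.
Local Notation mom := (mom P c lam).
Local Notation V := (kvol P c).
Local Notation pb := (pb lam).

(* Chebyshev's inequality for the volume under the law tilted by its N-th power. *)
Lemma good_mass (v e : R) N : 0 < v -> v <= mom 1 ->
  mom N <= (1 + e) * v ^+ N -> mom N.+2 <= (1 + e) * v ^+ N.+2 ->
  (1 - 8 * e) * v ^+ N <= \sum_(w | v / 2 <= V w <= 2 * v) pb w * V w ^+ N.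
Proof.
move=> v0 v1 hN hN2.
have gN := mom_ge lam0 N (ltW v0) v1.
have gN1 := mom_ge lam0 N.+1 (ltW v0) v1.
have bad : \sum_(w | ~~ (v / 2 <= V w <= 2 * v)) pb w * V w ^+ N <= 8 * e * v ^+ N.
  (* Outside the window |V w - v| is at least v / 2, whence the factor 4 / v^2. The sum is then at
     most 2 e v^(N+2) by the bounds on the moments. *)
  apply: (@le_trans _ _ (4 / v ^+ 2 * \sum_w pb w * (V w ^+ N * (V w - v) ^+ 2))).
    rewrite mulr_sumr big_mkcond; apply: ler_sum => w _.
    have p0 : 0 <= pb w * V w ^+ N by rewrite mulr_ge0 ?pb_ge0// exprn_ge0// kvol_ge0.
    have -> : 4 / v ^+ 2 * (pb w * (V w ^+ N * (V w - v) ^+ 2)) =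
        (pb w * V w ^+ N) * (4 * (V w - v) ^+ 2 / v ^+ 2) by ring.
    case: ifPn => [|_]; last first.
      apply: mulr_ge0 => //; apply: divr_ge0; last exact: sqr_ge0.
      by apply: mulr_ge0; [exact: ler0n|exact: sqr_ge0].
    rewrite negb_and -!ltNge => hw; rewrite ler_peMr//.
    rewrite ler_pdivlMr ?exprn_gt0// mul1r.
    have V0 := kvol_ge0 P c w.
    by case/orP: hw => hw; nra.
  rewrite (_ : \sum_w _ = mom N.+2 - 2 * v * mom N.+1 + v ^+ 2 * mom N); last first.
    rewrite /mom !mulr_sumr -sumrB -big_split/=; apply: eq_bigr => w _.
    rewrite !exprS; ring.
  have -> : 8 * e * v ^+ N = 4 / v ^+ 2 * (2 * e * v ^+ N.+2).
    by rewrite !exprS; field; exact: lt0r_neq0.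
  rewrite ler_wpM2l ?divr_ge0 ?sqr_ge0//.
  have h1 : v * v ^+ N.+1 <= v * mom N.+1 by apply: ler_wpM2l gN1; exact: ltW.
  have h2 : v ^+ 2 * mom N <= v ^+ 2 * ((1 + e) * v ^+ N) by apply: ler_wpM2l hN; exact: sqr_ge0.
  have e1 : v * v ^+ N.+1 = v ^+ N.+2 by rewrite -exprS.
  have e2 : v ^+ 2 * ((1 + e) * v ^+ N) = (1 + e) * v ^+ N.+2 by rewrite !exprS; ring.
  rewrite e1 in h1; rewrite e2 in h2; lra.
have : mom N = \sum_(w | v / 2 <= V w <= 2 * v) pb w * V w ^+ N +
  \sum_(w | ~~ (v / 2 <= V w <= 2 * v)) pb w * V w ^+ N by rewrite /mom (bigID (fun w => v / 2 <= V w <= 2 * v)).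
lra.
Qed.

Context d' (U : measurableType d') (Pu : probability U R).

Lemma Ex_pprod_fst N (f : N.-tuple E -> R) : bmf f ->
  Ex (pprod (pw P N) Pu) (fun z => f z.1) = Ex (pw P N) f.
Proof.
move=> bf; rewrite -[RHS]mulr1 -(Ex_cst Pu 1) -Ex_product//; last exact: bmf_cst.
by congr Ex; apply/funext => z; rewrite mulr1.
Qed.

(* The density [gap] dominates the product density, so that the error made by
   exchanging them in an expectation is controlled by their total masses. *)
Lemma family_test (W : E -> R) (v e p : R) N (psi : N.-tuple E * U -> R) :
  bmf W -> (forall x, 0 <= W x <= expR (- rate c lam x)) -> Ex P W = v -> 0 < v ->
  mom N <= (1 + e) * v ^+ N -> mom N.+2 <= (1 + e) * v ^+ N.+2 ->
  bmf psi -> (forall z, 0 <= psi z <= 1) -> 0 <= p ->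
  (forall w, 0 < pb w -> v / 2 <= V w <= 2 * v -> p * V w ^+ N <=
     Ex (pprod (pw P N) Pu) (fun z => (\prod_i (kept c w (tnth z.1 i))%:R) * psi z)) ->
  p * ((1 - 8 * e) * v ^+ N) <=
  Ex (pprod (pw P N) Pu) (fun z => (\prod_i W (tnth z.1 i)) * psi z) + e * v ^+ N.
Proof.
move=> bW hW vE v0 hN hN2 bpsi hpsi p0 hp.
have v1 : v <= mom 1.
  rewrite (mom1 P lam mc) -vE; apply: Ex_le => // [|x]; first exact: (bmf_expN_rate lam mc).
  by case/andP: (hW x).
have bk w : bmf (fun z : N.-tuple E * U => \prod_i (kept c w (tnth z.1 i))%:R : R).
  exact: (bmf_comp measurable_fst (bmf_kept_prod mc N w)).
have bWp : bmf (fun X : N.-tuple E => \prod_i W (tnth X i)).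
  by apply: bmf_prod => i _; exact: bmf_tnth.
have bWz : bmf (fun z : N.-tuple E * U => \prod_i W (tnth z.1 i)).
  exact: (bmf_comp measurable_fst bWp).
have bgz : bmf (fun z : N.-tuple E * U => gap c lam z.1).
  exact: (bmf_comp measurable_fst (bmf_gap lam mc N)).
apply: (@le_trans _ _ (Ex (pprod (pw P N) Pu) (fun z => gap c lam z.1 * psi z))).
  (* Only families with volume in the window are retained: there the test is known to succeed, and
     they carry nearly all the tilted mass. *)
  apply: (@le_trans _ _ (\sum_(w | v / 2 <= V w <= 2 * v) p * (pb w * V w ^+ N))).
    by rewrite -mulr_sumr ler_wpM2l//; exact: good_mass.
  rewrite (_ : (fun z => gap c lam z.1 * psi z) =
    fun z => \sum_w pb w * ((\prod_i (kept c w (tnth z.1 i))%:R) * psi z)); last first.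
    by apply/funext => z; rewrite gapE mulr_suml; apply: eq_bigr => w _; rewrite mulrA.
  rewrite Ex_sum => [|w _]; last by apply: bmfM; [exact: bmf_cst|exact: bmfM].
  rewrite big_mkcond; apply: ler_sum => w _.
  rewrite ExZ; last exact: bmfM.
  have E0 : 0 <= Ex (pprod (pw P N) Pu) (fun z => (\prod_i (kept c w (tnth z.1 i))%:R) * psi z).
    apply: Ex_ge0 => z; rewrite mulr_ge0//; last by case/andP: (hpsi z).
    by apply: prodr_ge0 => i _; exact: ler0n.
  have := pb_ge0 lam0 w; rewrite le_eqVlt => /predU1P[<-|pw0].
    by rewrite !mul0r mulr0; case: ifP.
  case: ifP => [gw|_]; last by rewrite mulr_ge0// ltW.
  rewrite mulrCA; apply: ler_wpM2l; [exact: ltW|exact: hp].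
apply: (@le_trans _ _ (Ex (pprod (pw P N) Pu) (fun z => (\prod_i W (tnth z.1 i)) * psi z +
    (gap c lam z.1 - \prod_i W (tnth z.1 i))))).
  apply: Ex_le => [||z]; [exact: bmfM|apply: bmfD; [exact: bmfM|exact: bmfB]|].
  have hg : \prod_i W (tnth z.1 i) <= gap c lam z.1.
    by apply: le_trans (gap_ge_prod c lam0 z.1); apply: ler_prod.
  have /andP[q0 q1] := hpsi z.
  rewrite -lerBlDl -mulrBl -[leRHS]mulr1 ler_wpM2l// subr_ge0//.
rewrite ExD; [|exact: bmfM|exact: bmfB].
rewrite lerD2l ExB// (Ex_pprod_fst bWp) (Ex_pprod_fst (bmf_gap lam mc N)).
rewrite -(momE P lam mc) (Ex_pw_expn P N bW) vE.
by rewrite lerBlDr -[X in _ <= _ + X]mul1r -mulrDl addrC.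
Qed.

End tilted.

(** * Block means *)

Section nested_power.
Context {R : realType} d (X : measurableType d) (P : probability X R) (k T n : nat).

Lemma Ex_pw3_prod (F : 'I_k -> 'I_T -> 'I_n -> X -> R) : (forall r l j, bmf (F r l j)) ->
  Ex (pw (pw (pw P n) T) k)
    (fun x => \prod_r \prod_l \prod_j F r l j (tnth (tnth (tnth x r) l) j)) =
  \prod_r \prod_l \prod_j Ex P (F r l j).
Proof.
move=> bF.
have bF1 r l : bmf (fun v : n.-tuple X => \prod_j F r l j (tnth v j)).
  by apply: bmf_prod => j _; exact: (bmf_tnth j (bF r l j)).
have bF2 r : bmf (fun t : T.-tuple (n.-tuple X) => \prod_l \prod_j F r l j (tnth (tnth t l) j)).
  by apply: bmf_prod => l _; exact: (bmf_tnth l (bF1 r l)).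
rewrite (Ex_pw_prod _ bF2); apply: eq_bigr => r _.
rewrite (Ex_pw_prod _ (bF1 r)); apply: eq_bigr => l _.
by rewrite (Ex_pw_prod _ (bF r l)).
Qed.

End nested_power.

Section blocks.
Context {R : realType}.
Local Notation TR := (measurableTypeR R).
Local Notation y0 := (@y0 R).

Lemma bmf_expN_clamp : bmf (fun x : TR => expR (- clamp x)).
Proof.
rewrite (_ : (fun x : TR => _) = fun x => expR (-1 * clamp x)); first exact: bmf_expR_clamp.
by apply/funext => x; rewrite mulN1r.
Qed.

Lemma y0_gt0 : 0 < y0.
Proof. by apply: lt_trans y0_gt_half; rewrite invr_gt0. Qed.

Section block.
Variable n : nat.
Hypothesis n0 : (0 < n)%N.

(* The mean of e^-x over a block of coordinates; its expectation is y0, so that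
   the normalised products [blk] concentrate around 1. *)
Definition bmean (v : n.-tuple TR) : R := n%:R^-1 * \sum_j expR (- clamp (tnth v j)).

Let nR : 0 < n%:R :> R. Proof. by rewrite ltr0n. Qed.

Lemma bmf_coord (j : 'I_n) : bmf (fun v : n.-tuple TR => expR (- clamp (tnth v j))).
Proof. exact: (bmf_tnth j bmf_expN_clamp). Qed.

Lemma bmf_bmean : bmf bmean.
Proof. by apply: bmfM; [exact: bmf_cst|apply: bmf_sum => j _; exact: bmf_coord]. Qed.

Lemma prod_pred1 (I : finType) (i : I) (F : I -> R) :
  (\prod_l (if l == i then F l else 1)) = F i.
Proof. by rewrite -big_mkcond big_pred1_eq. Qed.

Lemma Ex_tnth (j : 'I_n) d (T : measurableType d) (P : probability T R) (f : T -> R) :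
  bmf f -> Ex (pw P n) (fun x => f (tnth x j)) = Ex P f.
Proof.
move=> bf.
have := @Ex_pw_prod _ _ _ P n (fun l => if l == j then f else fun=> 1).
move=> h; transitivity (\prod_l Ex P (if l == j then f else fun=> 1)).
  rewrite -h => [|l]; last by case: eqP => // _; exact: bmf_cst.
  congr Ex; apply/funext => x; rewrite -(prod_pred1 j (fun l => f (tnth x l))).
  by apply: eq_bigr => l _; case: eqP.
rewrite -[RHS](prod_pred1 j (fun=> Ex P f)); apply: eq_bigr => l _; case: eqP => // _.
exact: Ex_cst.
Qed.

Lemma Ex_tnth2 (i j : 'I_n) d (T : measurableType d) (P : probability T R) (f : T -> R) :
  i != j -> bmf f -> Ex (pw P n) (fun x => f (tnth x i) * f (tnth x j)) = Ex P f ^+ 2.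
Proof.
move=> ij bf.
pose F (G : 'I_n -> R) := \prod_l ((if l == i then G l else 1) * (if l == j then G l else 1)).
have FE G : F G = G i * G j by rewrite /F big_split/= !prod_pred1.
have := @Ex_pw_prod _ _ _ P n (fun l => if (l == i) || (l == j) then f else fun=> 1).
move=> h; transitivity (\prod_l Ex P (if (l == i) || (l == j) then f else fun=> 1)).
  rewrite -h => [|l]; last by case: ifP => // _; exact: bmf_cst.
  congr Ex; apply/funext => x; rewrite -(FE (fun l => f (tnth x l))).
  apply: eq_bigr => l _; have [->|li] := eqVneq l i; first by rewrite (negPf ij)/= mulr1.
  by rewrite mul1r/=; case: eqP.
rewrite expr2 -(FE (fun=> Ex P f)); apply: eq_bigr => l _.
have [->|li] := eqVneq l i; first by rewrite (negPf ij)/= mulr1.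
by rewrite mul1r/=; case: eqP => // _; exact: Ex_cst.
Qed.

Lemma Ex_bmean : Ex (pw U01 n) bmean = y0.
Proof.
rewrite ExZ; last by apply: bmf_sum => j _; exact: bmf_coord.
rewrite Ex_sum => [|j _]; last exact: bmf_coord.
rewrite (eq_bigr (fun=> y0)) => [|j _]; last by rewrite (Ex_tnth j U01 bmf_expN_clamp) Ex_y0.
by rewrite sumr_const card_ord -[y0 *+ n]mulr_natl mulKf// lt0r_neq0.
Qed.

(** Of the n^2 pairs of coordinates, distinct ones are independent and contribute y0^2, while the n
    diagonal ones contribute at most 1. *)
Lemma Ex_bmean2 : Ex (pw U01 n) (fun v => bmean v ^+ 2) <= y0 ^+ 2 + n%:R^-1.
Proof.
have bb i j : bmf (fun v : n.-tuple TR => expR (- clamp (tnth v i)) * expR (- clamp (tnth v j))).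
  by apply: bmfM; exact: bmf_coord.
rewrite (_ : (fun v => _) = fun v => n%:R^-1 ^+ 2 *
   \sum_i \sum_j expR (- clamp (tnth v i)) * expR (- clamp (tnth v j))); last first.
  apply/funext => v; rewrite /bmean exprMn [X in _ * X]expr2 mulr_suml; congr (_ * _).
  by apply: eq_bigr => i _; rewrite mulr_sumr.
rewrite ExZ; last by apply: bmf_sum => i _; apply: bmf_sum => j _; exact: bb.
rewrite Ex_sum => [|i _]; last by apply: bmf_sum => j _; exact: bb.
apply: (@le_trans _ _ (n%:R^-1 ^+ 2 * \sum_(i < n) (n%:R * y0 ^+ 2 + 1))); last first.
  rewrite sumr_const card_ord -[_ *+ n]mulr_natl le_eqVlt; apply/orP; left; apply/eqP.
  by field; exact: lt0r_neq0.
rewrite ler_wpM2l ?exprn_ge0 ?invr_ge0//; apply: ler_sum => i _.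
rewrite Ex_sum => [|j _]; last exact: bb.
rewrite (bigD1 i)//= addrC lerD//; last first.
  rewrite -(Ex_cst (pw U01 n) 1); apply: Ex_le => // [|x]; first exact: bmf_cst.
  by rewrite mulr_ile1 ?expR_ge0// expR_le1 oppr_le0 clamp_ge0.
rewrite (eq_bigr (fun=> y0 ^+ 2)) => [|j ji]; last first.
  by rewrite (Ex_tnth2 U01 _ bmf_expN_clamp) ?Ex_y0// eq_sym.
rewrite sumr_const -[leLHS]mulr_natl ler_wpM2r ?sqr_ge0// ler_nat.
by rewrite cardC1 card_ord leq_pred.
Qed.

Variable T : nat.

(** The normalised product s_r of one group of [T] blocks. *)
Definition blk (t : T.-tuple (n.-tuple TR)) : R := \prod_l (bmean (tnth t l) / y0).

Local Notation PB := (pw (pw U01 n) T).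

Let bmf_bmy : bmf (fun v : n.-tuple TR => bmean v / y0).
Proof. by apply: bmfM; [exact: bmf_bmean|exact: bmf_cst]. Qed.

Lemma bmf_blk : bmf blk.
Proof. by apply: bmf_prod => l _; exact: (bmf_tnth l bmf_bmy). Qed.

Lemma Ex_blk : Ex PB blk = 1.
Proof.
rewrite (Ex_pw_expn (pw U01 n) T bmf_bmy) ExZr; last exact: bmf_bmean.
by rewrite Ex_bmean divff ?expr1n// lt0r_neq0// y0_gt0.
Qed.

Lemma Ex_blk2 : Ex PB (fun t => blk t ^+ 2) <= (1 + 4 / n%:R) ^+ T.
Proof.
have bm2 : bmf (fun v : n.-tuple TR => (bmean v / y0) ^+ 2) by exact: bmfX.
rewrite (_ : (fun t => _) = fun t => \prod_l (bmean (tnth t l) / y0) ^+ 2); last first.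
  by apply/funext => t; rewrite /blk prodrXl.
rewrite (Ex_pw_expn (pw U01 n) T bm2); apply: lerXn2r; rewrite ?nnegrE.
- by apply: Ex_ge0 => x; exact: sqr_ge0.
- by rewrite addr_ge0// divr_ge0.
rewrite (_ : (fun v => _) = fun v => bmean v ^+ 2 * y0^-1 ^+ 2); last first.
  by apply/funext => v; rewrite exprMn.
rewrite ExZr; last exact: bmfX bmf_bmean.
rewrite exprVn ler_pdivrMr ?exprn_gt0 ?y0_gt0//; apply: (le_trans Ex_bmean2).
rewrite mulrDl mul1r lerD2l mulrAC ler_peMl ?invr_ge0//.
have := @y0_gt_half R; set y := y0 => hy; nra.
Qed.

(** From |z| <= (th + z^2 / th) / 2, which replaces Cauchy-Schwarz; [th] is later taken to be the
    expected size 1/B of the deviation. *)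
Lemma Ex_blk_dev (th : R) : 0 < th ->
  Ex PB (fun t => `|1 - blk t|) <= (th + th^-1 * ((1 + 4 / n%:R) ^+ T - 1)) / 2.
Proof.
move=> th0.
have b2 : bmf (fun t => blk t ^+ 2) by exact: bmfX bmf_blk.
have b1 := bmf_blk.
have bc c : bmf (fun t : T.-tuple (n.-tuple TR) => c) by exact: bmf_cst.
have [cc ccE] : exists cc, cc = th / 2 + th^-1 / 2 by eexists.
apply: (@le_trans _ _ (Ex PB (fun t => cc + (- th^-1 * blk t + th^-1 / 2 * blk t ^+ 2)))).
  apply: Ex_le => [||t].
  - by apply: bmf_norm; apply: bmfB.
  - by apply: bmfD => //; apply: bmfD; apply: bmfM.
  rewrite (_ : _ + _ = (th + th^-1 * `|1 - blk t| ^+ 2) / 2); last by rewrite real_normK ?num_real// ccE; field; exact: lt0r_neq0.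
  set a := `|_|; rewrite ler_pdivlMr// -subr_ge0.
  rewrite (_ : _ - _ = th^-1 * (th - a) ^+ 2); last by field; exact: lt0r_neq0.
  by rewrite mulr_ge0 ?sqr_ge0// invr_ge0 ltW.
rewrite ExD//; last by apply: bmfD; apply: bmfM.
rewrite ExD; [|by apply: bmfM|by apply: bmfM].
rewrite Ex_cst (ExZ PB (- th^-1) b1) (ExZ PB (th^-1 / 2) b2) Ex_blk mulr1.
have := Ex_blk2; set X := Ex _ _; set Z := _ ^+ T => XZ.
rewrite [leLHS](_ : _ = (th + th^-1 * (X - 1)) / 2); last by rewrite ccE; field; exact: lt0r_neq0.
by rewrite ler_pM2r ?invr_gt0// lerD2l ler_pM2l ?invr_gt0// lerD2r.
Qed.

Variable k : nat.
Local Notation PE := (pw PB k).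

Definition zprod (x : k.-tuple (T.-tuple (n.-tuple TR))) : R := \prod_r (1 - blk (tnth x r)).
Definition uprod (x : k.-tuple (T.-tuple (n.-tuple TR))) : R := \prod_r (1 + blk (tnth x r)).

Let b1m : bmf (fun t => 1 - blk t).
Proof. by apply: bmfB; [exact: bmf_cst|exact: bmf_blk]. Qed.

Let b1p : bmf (fun t => 1 + blk t).
Proof. by apply: bmfD; [exact: bmf_cst|exact: bmf_blk]. Qed.

Lemma bmf_zprod : bmf zprod.
Proof. by apply: bmf_prod => r _; exact: (bmf_tnth r b1m). Qed.

Lemma bmf_uprod : bmf uprod.
Proof. by apply: bmf_prod => r _; exact: (bmf_tnth r b1p). Qed.

Lemma Ex_uprod : Ex PE uprod = 2 ^+ k.
Proof.
rewrite (Ex_pw_expn PB k b1p) ExD ?Ex_cst ?Ex_blk//; [exact: bmf_cst|exact: bmf_blk].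
Qed.

(** The groups are independent, so k small factors multiply; this is the source of the arbitrary
    polynomial decay. *)
Lemma Ex_zprod (th : R) : 0 < th ->
  Ex PE (fun x => `|zprod x|) <= ((th + th^-1 * ((1 + 4 / n%:R) ^+ T - 1)) / 2) ^+ k.
Proof.
move=> th0.
rewrite (_ : (fun x => _) = fun x => \prod_r `|1 - blk (tnth x r)|); last first.
  by apply/funext => x; rewrite /zprod normr_prod.
have bn : bmf (fun t => `|1 - blk t|) by exact: bmf_norm.
rewrite (Ex_pw_expn PB k bn).
have E0 : 0 <= Ex PB (fun t => `|1 - blk t|) by apply: Ex_ge0 => t.
by rewrite lerXn2r ?nnegrE ?Ex_blk_dev//; apply: le_trans (Ex_blk_dev th0).
Qed.

End block.
End blocks.

(** * The random halfspaces *)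

Section counting.
Context {R : realType}.

(** With z = 2^h e^-S, the number of levels at which a word would cut is z up to an error of one;
    this is the first of the two bounds. *)
Lemma count_lt_le (g : nat) (z : R) : 0 <= z ->
  \sum_(u < g) (u.+1%:R < z)%R%:R <= z /\ \sum_(u < g) (u.+1%:R < z :> R)%R%:R <= g%:R :> R.
Proof.
move=> z0; elim: g => [|g [IH1 IH2]]; first by rewrite !big_ord0.
rewrite !big_ord_recr /=; case: ltP => [gz|_]; rewrite ?addr0; last first.
  by split => //; apply: (le_trans IH2); rewrite ler_nat.
split; last by rewrite -addn1 natrD lerD2r.
by apply: le_trans (ltW gz); rewrite -[g.+1]addn1 natrD lerD2r.
Qed.

Lemma count_lt_ge (g : nat) (z : R) : 0 <= z <= g%:R ->
  z - 1 <= \sum_(u < g) (u.+1%:R < z)%R%:R.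
Proof.
move=> /andP[z0 zg].
(* Induction on [g] would lose the hypothesis z <= g; the second alternative, that every level so
   far counts, replaces it. *)
suff : z - 1 <= \sum_(u < g) (u.+1%:R < z)%R%:R \/ g%:R <= \sum_(u < g) (u.+1%:R < z :> R)%R%:R :> R.
  by case => // h; apply: le_trans h; lra.
elim: g {zg} => [|g IH]; first by right; rewrite big_ord0.
rewrite big_ord_recr /=; case: ltP => [gz|zg]; rewrite ?addr0.
  case: IH => [h|h]; first by left; apply: (le_trans h); rewrite lerDl.
  by right; rewrite -addn1 natrD lerD2r.
left; case: IH => // h; apply: le_trans h; rewrite lerBlDr.
by apply: (le_trans zg); rewrite -addn1 natrD.
Qed.

(** Doubling the range adds 2^h terms, each at most 2^-h. *)
Lemma harmonic_pow2 h : \sum_(u < 2 ^ h) u.+1%:R^-1 <= h.+1%:R :> R.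
Proof.
elim: h => [|h IH]; first by rewrite expn0 big_ord1 invr1.
rewrite expnS mul2n -addnn big_split_ord/= -[h.+2]addn1 natrD lerD//.
apply: (@le_trans _ _ (\sum_(i < 2 ^ h) ((2 ^ h)%:R : R)^-1)).
  apply: ler_sum => i _; rewrite lef_pV2 ?posrE ?ltr0n ?expn_gt0// ler_nat.
  by rewrite (leq_trans (leq_addr i _)).
by rewrite sumr_const card_ord -[leLHS]mulr_natl divff// pnatr_eq0 expn_eq0.
Qed.

End counting.

Lemma bmf_lt (R : realType) d (E : measurableType d) (f : E -> R) (t : R) :
  bmf f -> bmf (fun x => (t < f x)%R%:R : R).
Proof.
move=> [mf _].
rewrite (_ : (fun x => _) = \1_(f @^-1` `]t, +oo[)).
  by apply: bmf_indic; rewrite -[X in measurable X]setTI; exact: mf.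
apply/funext => x; rewrite indicE; congr ((_ : bool)%:R).
by apply/idP/idP => [h|/set_mem]; [apply/mem_set|]; rewrite /= in_itv/= andbT.
Qed.

Section cuts.
Context {R : realType}.
Variables (k T n h : nat).
Local Notation TR := (measurableTypeR R).
Local Notation y0 := (@y0 R).
Local Notation b0 := (@b0 R).
Local Notation PE := (pw (pw (pw (@U01 R) n) T) k).
Implicit Types (J : {set 'I_k}) (w : {ffun 'I_k * 'I_T -> 'I_n}) (u : 'I_(2 ^ h)).

(* A cut (J, w, u) uses the groups of blocks r in J, picks the coordinate w (r, l)
   in the block (r, l), and has level about (u + 1) / 2^h. *)
Definition cut_type : finType := ({set 'I_k} * {ffun 'I_k * 'I_T -> 'I_n} * 'I_(2 ^ h))%type.

Definition wsum J w (y : 'I_k -> 'I_T -> 'I_n -> R) : R :=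
  \sum_(p | p.1 \in J) y p.1 p.2 (w p).

(* The truncation at 2^-(T #|J|) > e^-(T #|J|) keeps the corner (1, ..., 1) of the cube. *)
Definition threshold J u : R := Num.max (u.+1%:R / (2 ^ h)%:R) (2^-1 ^+ (T * #|J|)).

(** The strict inequality leaves a closed halfspace. Abstract coordinates [y] let one test serve
    both outcomes ([crd]) and vectors ([coords]). *)
Definition is_cut (s : cut_type) (y : 'I_k -> 'I_T -> 'I_n -> R) : bool :=
  threshold s.1.1 s.2 < expR (- wsum s.1.1 s.1.2 y).

Definition crd (x : k.-tuple (T.-tuple (n.-tuple TR))) r l j : R :=
  clamp (tnth (tnth (tnth x r) l) j).

Definition ccut (s : cut_type) x : bool := is_cut s (crd x).

Lemma sum_cut_type (F : cut_type -> R) :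
  \sum_s F s = \sum_J \sum_w \sum_u F (J, w, u).
Proof.
rewrite (eq_bigr (fun J => \sum_(p : {ffun 'I_k * 'I_T -> 'I_n} * 'I_(2 ^ h)) F (J, p.1, p.2))); last first.
  by move=> J _; rewrite pair_bigA.
rewrite pair_bigA/= (reindex (fun p : {set 'I_k} * ({ffun 'I_k * 'I_T -> 'I_n} * 'I_(2 ^ h)) => (p.1, p.2.1, p.2.2) : cut_type))//=.
exists (fun s : cut_type => (s.1.1, (s.1.2, s.2))); first by move=> [J [w u]].
by move=> [[J w] u].
Qed.

Lemma expR_wsum J w y (t : R) : expR (- (wsum J w y * t)) =
  \prod_r \prod_l (if r \in J then expR (- (y r l (w (r, l)) * t)) else 1).
Proof.
rewrite /wsum mulr_suml -sumrN expR_sum big_mkcond/= pair_bigA/=.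
by apply: eq_bigr => -[r l] _.
Qed.

Lemma bmf_wsum_prod J w (t : R) : bmf (fun x => expR (- (wsum J w (crd x) * t))).
Proof.
apply: bmf_expR; apply: bmfN; apply: bmfM; last exact: bmf_cst.
apply: bmf_sum => p _.
exact: (bmf_tnth p.1 (bmf_tnth p.2 (bmf_tnth (w p) bmf_clamp))).
Qed.

Lemma bmf_ccut (s : cut_type) : bmf (fun x => (ccut s x)%:R : R).
Proof.
rewrite /ccut /is_cut; apply: bmf_lt.
rewrite (_ : (fun x => _) = fun x => expR (- (wsum s.1.1 s.1.2 (crd x) * 1))).
  exact: bmf_wsum_prod.
by apply/funext => x; rewrite mulr1.
Qed.

Lemma wsum_ge0 J w y : (forall r l j, 0 <= y r l j) -> 0 <= wsum J w y.
Proof. by move=> h0; apply: sumr_ge0 => p _. Qed.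

Lemma crd_ge0 x r l j : 0 <= crd x r l j.
Proof. exact: clamp_ge0. Qed.

Hypothesis n0 : (0 < n)%N.
Let nR : 0 < n%:R :> R. Proof. by rewrite ltr0n. Qed.
Let GR : 0 < (2 ^ h)%:R :> R. Proof. by rewrite ltr0n expn_gt0. Qed.
Let nkT : 0 < n%:R ^+ (k * T) :> R. Proof. by rewrite exprn_gt0. Qed.

Lemma sum_words_cst (c : R) :
  \sum_(w : {ffun 'I_k * 'I_T -> 'I_n}) c = n%:R ^+ (k * T) * c.
Proof. by rewrite sumr_const card_ffun card_prod !card_ord -natrX mulr_natl. Qed.

Lemma prod_in_exp J (c : R) : \prod_r \prod_(l < T) (if r \in J then c else 1) = c ^+ (T * #|J|).
Proof.
rewrite (eq_bigr (fun r => if r \in J then c ^+ T else 1)).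
  by rewrite -big_mkcond/= prodr_const exprM.
by move=> r _; rewrite prodr_const card_ord; case: ifP => //; rewrite expr1n.
Qed.

(** A sum over words of a product over blocks is the product of the block sums. Words also choose
    coordinates in groups outside [J]; each such block gives a bare factor n, so the power of n does
    not depend on [J]. *)
Lemma sum_words J x : \sum_w expR (- wsum J w (crd x)) =
  n%:R ^+ (k * T) * y0 ^+ (T * #|J|) * \prod_(r in J) blk (tnth x r).
Proof.
pose F (p : 'I_k * 'I_T) j : R := if p.1 \in J then expR (- crd x p.1 p.2 j) else 1.
transitivity (\sum_(w : {ffun 'I_k * 'I_T -> 'I_n}) \prod_p F p (w p)).
  apply: eq_bigr => w _; rewrite -[wsum _ _ _]mulr1 expR_wsum pair_bigA/=.
  by apply: eq_bigr => -[r l] _; rewrite /F/= mulr1.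
rewrite -bigA_distr_bigA/=.
rewrite (eq_bigr (fun p => n%:R * ((if p.1 \in J then y0 else 1) *
   (if p.1 \in J then bmean (tnth (tnth x p.1) p.2) / y0 else 1)))); last first.
  move=> p _; rewrite /F; case: ifP => _.
    by rewrite [y0 * _]mulrC divfK ?lt0r_neq0 ?y0_gt0// /bmean mulVKf// lt0r_neq0.
  by rewrite sumr_const card_ord mulr1 mulr1.
rewrite !big_split/= prodr_const card_prod !card_ord -mulrA; congr (_ * (_ * _)).
  by rewrite -prod_in_exp pair_bigA.
rewrite [RHS]big_mkcond/= -(pair_bigA _ (fun r l => if r \in J then bmean (tnth (tnth x r) l) / y0 else 1))/=.
by apply: eq_bigr => r _; case: ifP => // _; rewrite big1.
Qed.

Variables (L : R) (m : nat).
Hypothesis L0 : 0 <= L.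
Variable a : nat.
Hypothesis am : (a <= m)%N.

(* Expanding both products in [pot] over the subsets J gives these coefficients,
   which are nonnegative because a <= m. *)
Definition gcoef J : R := if J == finset.set0 then 0 else L * (m%:R - (-1) ^+ #|J| * a%:R).
(** The power of y0 cancels the one in [sum_words]; [clam] then spreads this weight evenly over
    words and levels. *)
Definition alpha J : R := gcoef J * y0^-1 ^+ (T * #|J|).
Definition clam (s : cut_type) : R := alpha s.1.1 / (n%:R ^+ (k * T) * (2 ^ h)%:R).
Definition pot (x : k.-tuple (T.-tuple (n.-tuple TR))) : R :=
  L * m%:R * (uprod x - 1) - L * a%:R * (zprod x - 1).

Lemma gcoef_ge0 J : 0 <= gcoef J.
Proof.
rewrite /gcoef; case: ifP => // _; rewrite mulr_ge0// subr_ge0.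
have aR : a%:R <= m%:R :> R by rewrite ler_nat.
have a0 : 0 <= a%:R :> R by [].
by rewrite -signr_odd; case: odd; rewrite ?expr1 ?expr0; lra.
Qed.

Lemma gcoef_le J : gcoef J <= 2 * m%:R * L.
Proof.
rewrite /gcoef; case: ifP => _; first by rewrite !mulr_ge0.
rewrite mulrC ler_wpM2r//.
have aR : a%:R <= m%:R :> R by rewrite ler_nat.
have a0 : 0 <= a%:R :> R by [].
by rewrite -signr_odd; case: odd; rewrite ?expr1 ?expr0; lra.
Qed.

Lemma alpha_ge0 J : 0 <= alpha J.
Proof. by rewrite mulr_ge0 ?gcoef_ge0// exprn_ge0// invr_ge0 ltW// y0_gt0. Qed.

Lemma clam_ge0 s : 0 <= clam s.
Proof. by rewrite divr_ge0 ?alpha_ge0// ltW// mulr_gt0. Qed.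

Lemma potE x : pot x = \sum_J gcoef J * \prod_(r in J) blk (tnth x r).
Proof.
rewrite /pot.
have -> : uprod x = \sum_(J : {set 'I_k}) \prod_(r in J) blk (tnth x r).
  rewrite /uprod; under eq_bigr do rewrite addrC.
  by rewrite bigA_distr; apply: eq_big => [J|J _]; [rewrite inE|rewrite [RHS]big_mkcond].
have -> : zprod x = \sum_(J : {set 'I_k}) (-1) ^+ #|J| * \prod_(r in J) blk (tnth x r).
  rewrite /zprod; under eq_bigr do rewrite addrC.
  rewrite bigA_distr; apply: eq_big => [J|J _]; first by rewrite inE.
  by rewrite -big_mkcond/= prodrN.
rewrite (bigD1 finset.set0)//= big_set0 addrC addrK.
rewrite [X in X - 1](bigD1 finset.set0)//= cards0 big_set0 expr0 mul1r [1 + _ - 1]addrC addKr.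
rewrite [RHS](bigD1 finset.set0)//= {1}/gcoef eqxx mul0r add0r !mulr_sumr -sumrB.
by apply: eq_bigr => J /negPf J0; rewrite /gcoef J0; ring.
Qed.

Lemma rateE x : rate ccut clam x = \sum_J alpha J / (n%:R ^+ (k * T) * (2 ^ h)%:R) *
  \sum_w \sum_u (threshold J u < expR (- wsum J w (crd x)))%R%:R.
Proof.
rewrite /rate sum_cut_type; apply: eq_bigr => J _.
rewrite mulr_sumr; apply: eq_bigr => w _; rewrite mulr_sumr.
by apply: eq_bigr => u _.
Qed.

Lemma alpha_words J x : alpha J / (n%:R ^+ (k * T) * (2 ^ h)%:R) *
    \sum_w ((2 ^ h)%:R * expR (- wsum J w (crd x))) = gcoef J * \prod_(r in J) blk (tnth x r).
Proof.
rewrite -mulr_sumr sum_words /alpha exprVn.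
have ? : y0 ^+ (T * #|J|) != 0 by rewrite expf_neq0// lt0r_neq0// y0_gt0.
by field; apply/and3P; split => //; exact: lt0r_neq0.
Qed.

Lemma rate_le_pot x : rate ccut clam x <= pot x.
Proof.
rewrite rateE potE; apply: ler_sum => J _; rewrite -alpha_words.
rewrite ler_wpM2l ?divr_ge0 ?alpha_ge0 ?(ltW (mulr_gt0 _ _))//.
apply: ler_sum => w _; set e := expR _.
have [h1 _] := @count_lt_le R (2 ^ h) ((2 ^ h)%:R * e) ltac:(by rewrite mulr_ge0// expR_ge0).
apply: le_trans h1; apply: ler_sum => u _; rewrite ler_nat.
rewrite /threshold gt_max; case: ltP => [|//].
by rewrite ltr_pdivrMr// mulrC => ->; case: (_ < _).
Qed.

(** The rate lost to the discretisation of levels, at most one level per word, and to the truncation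
    of thresholds. *)
Definition rounding : R := \sum_J alpha J * ((2 ^ h)%:R^-1 + 2^-1 ^+ (T * #|J|)).

Lemma pot_le_rate x : pot x - rounding <= rate ccut clam x.
Proof.
rewrite rateE potE /rounding -sumrB; apply: ler_sum => J _; rewrite -alpha_words.
set A := alpha J / _; set tau := _ ^+ (T * _).
have A0 : 0 <= A by rewrite divr_ge0 ?alpha_ge0 ?(ltW (mulr_gt0 _ _)).
have -> : alpha J * ((2 ^ h)%:R^-1 + tau) = A * \sum_(w : {ffun 'I_k * 'I_T -> 'I_n}) (1 + (2 ^ h)%:R * tau).
  rewrite sum_words_cst /A.
  by field; rewrite !lt0r_neq0.
rewrite -mulrBr ler_wpM2l// -sumrB; apply: ler_sum => w _; set e := expR _.
have e0 : 0 <= e by exact: expR_ge0.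
have e1 : e <= 1.
  by rewrite expR_le1 oppr_le0 wsum_ge0// => r l j; exact: crd_ge0.
(* A word with e <= tau cuts at no level, and its whole share 2^h e is charged to the truncation. *)
have [te|te] := ltP tau e; last first.
  apply: (@le_trans _ _ 0); last by apply: sumr_ge0 => u _; exact: ler0n.
  by have := ler_wpM2l (ltW GR) te; lra.
have := @count_lt_ge R (2 ^ h) ((2 ^ h)%:R * e).
rewrite mulr_ge0 ?(ltW GR)//= ler_piMr ?(ltW GR)// => /(_ isT) h1.
apply: (@le_trans _ _ ((2 ^ h)%:R * e - 1)).
  have : 0 <= (2 ^ h)%:R * tau by rewrite mulr_ge0 ?(ltW GR)// exprn_ge0.
  lra.
apply: (le_trans h1); apply: ler_sum => u _; rewrite ler_nat.
by rewrite /threshold gt_max te andbT ltr_pdivrMr// mulrC.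
Qed.

(** Markov's inequality for e^(-S/2): the indicator of U < e^-S is at most e^(-S/2) U^(-1/2). After
    squaring only 1/U remains, whose average over the levels is at most h + 1. *)
Lemma Ex_ccut_le J w u :
  Ex PE (fun x => (ccut (J, w, u) x)%:R) ^+ 2 <= b0 ^+ 2 ^+ (T * #|J|) * ((2 ^ h)%:R / u.+1%:R).
Proof.
have e1 : Ex PE (fun x => expR (- (wsum J w (crd x) * 2^-1))) = b0 ^+ (T * #|J|).
  pose F r l j (v : TR) : R := if (r \in J) && (j == w (r, l)) then expR (- (clamp v / 2)) else 1.
  have bF r l j : bmf (F r l j).
    rewrite /F; case: (_ && _); last exact: bmf_cst.
    rewrite [X in bmf X](_ : _ = fun v : TR => expR (- 2^-1 * clamp v)); first exact: bmf_expR_clamp.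
    by apply/funext => v; rewrite mulNr mulrC.
  transitivity (\prod_r \prod_l \prod_j Ex U01 (F r l j)).
    rewrite (_ : (fun x => _) = fun x => \prod_r \prod_l \prod_j F r l j (tnth (tnth (tnth x r) l) j)).
      exact: Ex_pw3_prod.
    apply/funext => x; rewrite expR_wsum; apply: eq_bigr => r _; apply: eq_bigr => l _.
    rewrite /F; case: (r \in J) => /=; last by rewrite big1.
    by rewrite -big_mkcond/= big_pred1_eq.
  rewrite -prod_in_exp; apply: eq_bigr => r _; apply: eq_bigr => l _.
  rewrite /F; case: (r \in J) => /=; last by rewrite big1// => j _; rewrite Ex_cst.
  rewrite (bigD1 (w (r, l)))//= eqxx Ex_b0 big1 ?mulr1// => j /negPf ->.
  exact: Ex_cst.
set U : R := u.+1%:R / (2 ^ h)%:R.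
have U0 : 0 < U by rewrite divr_gt0.
have -> : (2 ^ h)%:R / u.+1%:R = U^-1 by rewrite invf_div.
rewrite ler_pdivlMr// -[U]sqr_sqrtr ?(ltW U0)// -exprMn -exprM mulnC exprM.
have h0 : 0 <= Ex PE (fun x => (ccut (J, w, u) x)%:R) by apply: Ex_ge0 => x; exact: ler0n.
apply: lerXn2r; rewrite ?nnegrE ?mulr_ge0 ?sqrtr_ge0//.
  by rewrite -e1; apply: Ex_ge0 => x; exact: expR_ge0.
have bc := bmf_ccut (J, w, u); have bw := bmf_wsum_prod J w 2^-1.
rewrite -e1 -ExZr//; apply: Ex_le => // [|x]; first by apply: bmfM => //; exact: bmf_cst.
rewrite /ccut /is_cut/= /threshold gt_max; case: ltP => [hU|_] /=; last by rewrite mul0r expR_ge0.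
case: (_ < _) => /=; last by rewrite mul0r expR_ge0.
rewrite mul1r -(ler_pXn2r (n:=2))// ?nnegrE ?sqrtr_ge0 ?expR_ge0// sqr_sqrtr ?(ltW U0)//.
rewrite -expRM_natl; apply: ltW; rewrite (_ : _ * _ = - wsum J w (crd x))//.
by field.
Qed.

Lemma pairs_le_sum : pairs PE ccut clam <=
  h.+1%:R * \sum_J alpha J * b0 ^+ 2 ^+ (T * #|J|).
Proof.
rewrite /pairs sum_cut_type mulr_sumr; apply: ler_sum => J _.
apply: (@le_trans _ _ (\sum_(w : {ffun 'I_k * 'I_T -> 'I_n}) \sum_(u < 2 ^ h) alpha J / (n%:R ^+ (k * T) * (2 ^ h)%:R) *
   (b0 ^+ 2 ^+ (T * #|J|) * ((2 ^ h)%:R / u.+1%:R)))).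
  apply: ler_sum => w _; apply: ler_sum => u _; rewrite ler_wpM2l//.
    exact: (clam_ge0 (J, w, u)).
  exact: Ex_ccut_le.
rewrite sum_words_cst -!mulr_sumr.
have -> : n%:R ^+ (k * T) * (alpha J / (n%:R ^+ (k * T) * (2 ^ h)%:R) * (b0 ^+ 2 ^+ (T * #|J|) *
   ((2 ^ h)%:R * \sum_(i < 2 ^ h) i.+1%:R^-1))) =
  (\sum_(i < 2 ^ h) i.+1%:R^-1) * (alpha J * b0 ^+ 2 ^+ (T * #|J|)).
  by field; rewrite !lt0r_neq0.
by rewrite ler_wpM2r ?harmonic_pow2// mulr_ge0 ?alpha_ge0// exprn_ge0// sqr_ge0.
Qed.

(** There are 2^k subsets, and the exponent is at least T for a nonempty one. *)
Lemma sum_subsets_le (c q : R) : 0 <= c -> 0 <= q <= 1 ->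
  \sum_(J : {set 'I_k}) (if J == finset.set0 then 0 else c * q ^+ (T * #|J|)) <= 2 ^+ k * (c * q ^+ T).
Proof.
move=> c0 /andP[q0 q1].
have -> : 2 ^+ k * (c * q ^+ T) = \sum_(J : {set 'I_k}) c * q ^+ T.
  by rewrite sumr_const -cardsT -powersetT card_powerset cardsT card_ord -[RHS]mulr_natl natrX.
apply: ler_sum => J _; case: ifPn => [_|J0]; first by rewrite mulr_ge0// exprn_ge0.
rewrite ler_wpM2l//; apply: ler_wiXn2l => //.
by rewrite leq_pmulr// card_gt0.
Qed.

Lemma pairs_le : pairs PE ccut clam <= h.+1%:R * (2 ^+ k * (2 * m%:R * L * (b0 ^+ 2 / y0) ^+ T)).
Proof.
apply: (le_trans pairs_le_sum); rewrite ler_wpM2l//.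
have q1 : b0 ^+ 2 / y0 <= 1 by rewrite ler_pdivrMr ?y0_gt0// mul1r ltW// b0_sqr_lt_y0.
have q0 : 0 <= b0 ^+ 2 / y0 by rewrite divr_ge0 ?sqr_ge0// ltW// y0_gt0.
apply: le_trans (@sum_subsets_le (2 * m%:R * L) (b0 ^+ 2 / y0) _ _); last first.
- by rewrite q0.
- by rewrite !mulr_ge0.
apply: ler_sum => J _; case: ifPn => J0.
  by rewrite /alpha /gcoef J0 !mul0r.
rewrite /alpha -mulrA; apply: ler_pM.
- exact: gcoef_ge0.
- by apply: mulr_ge0; apply: exprn_ge0; [rewrite invr_ge0; exact/ltW/y0_gt0|exact: sqr_ge0].
- exact: gcoef_le.
- by rewrite [leRHS]exprMn mulrC.
Qed.

Hypothesis hTk : (T * k <= h)%N.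

Lemma rounding_le : rounding <= 2 ^+ k * (4 * m%:R * L * ((2 * y0)^-1) ^+ T).
Proof.
have y2 : 1 <= 2 * y0 by have := @y0_gt_half R; lra.
apply: le_trans (@sum_subsets_le (4 * m%:R * L) ((2 * y0)^-1) _ _); last first.
- by rewrite invr_ge0 invf_le1 ?y2 ?andbT//; lra.
- by rewrite !mulr_ge0.
apply: ler_sum => J _; case: ifPn => J0.
  by rewrite /alpha /gcoef J0 !mul0r.
(* As T #|J| <= T k <= h, the discretisation error is at most the truncation error. *)
apply: (@le_trans _ _ (alpha J * (2 * 2^-1 ^+ (T * #|J|)))).
  rewrite ler_wpM2l ?alpha_ge0// mulr_natl mulr2n lerD2r natrX -exprVn.
  apply: ler_wiXn2l; rewrite ?invr_ge0 ?invf_le1// ?ler1n//.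
  by apply: leq_trans hTk; rewrite leq_mul2l (leq_trans (max_card _)) ?card_ord// orbT.
rewrite /alpha; have -> : (2 * y0)^-1 ^+ (T * #|J|) = y0^-1 ^+ (T * #|J|) * 2^-1 ^+ (T * #|J|).
  by rewrite -exprMn invfM mulrC.
have -> : gcoef J * y0^-1 ^+ (T * #|J|) * (2 * 2^-1 ^+ (T * #|J|)) = (2 * gcoef J) * (y0^-1 ^+ (T * #|J|) * 2^-1 ^+ (T * #|J|)) by ring.
apply: ler_wpM2r; last by have := gcoef_le J; lra.
by apply: mulr_ge0; apply: exprn_ge0; rewrite invr_ge0//; exact/ltW/y0_gt0.
Qed.

End cuts.

(** * The common density and the error in the mean volume *)

Section envelope.
Context {R : realType}.
Variables (k T n h : nat).
Local Notation TR := (measurableTypeR R).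
Local Notation PE := (pw (pw (pw (@U01 R) n) T) k).
Local Notation ccut := (@ccut R k T n h).
Hypothesis n0 : (0 < n)%N.
Variables (L : R) (m : nat).
Hypothesis L0 : 0 <= L.

(* Up to the factor e^(-L a), a lower envelope of all the densities e^(-pot). *)
Definition env (x : k.-tuple (T.-tuple (n.-tuple TR))) : R :=
  expR (- (L * m%:R * (uprod x - 1) + L * m%:R * `|zprod x|)).
Definition envol : R := Ex PE env.
Definition zdev : R := Ex PE (fun x => `|zprod x|).

Local Notation uz x := (L * m%:R * (uprod x - 1) + L * m%:R * `|zprod x|).

Let Lm0 : 0 <= L * m%:R. Proof. by rewrite mulr_ge0. Qed.

Lemma bmf_uz : bmf (fun x : k.-tuple (T.-tuple (n.-tuple TR)) => uz x).
Proof.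
apply: bmfD; apply: bmfM; try exact: bmf_cst.
  by apply: bmfB; [exact: bmf_uprod|exact: bmf_cst].
by apply: bmf_norm; exact: bmf_zprod.
Qed.

Lemma bmf_env : bmf env.
Proof. by apply/bmf_expR/bmfN/bmf_uz. Qed.

Lemma zdev_ge0 : 0 <= zdev.
Proof. by apply: Ex_ge0 => x. Qed.

(* Jensen's inequality, through e^(-u) >= e^(-mu) (1 + mu - u). *)
Lemma envol_ge : expR (- (L * m%:R * (2 ^+ k - 1) + L * m%:R * zdev)) <= envol.
Proof.
have bu := @bmf_uprod R n T k.
have bz : bmf (fun x : k.-tuple (T.-tuple (n.-tuple TR)) => `|zprod x|) by apply: bmf_norm; exact: bmf_zprod.
have bc c : bmf (fun x : k.-tuple (T.-tuple (n.-tuple TR)) => c) by exact: bmf_cst.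
have buz := bmf_uz.
set mu := _ + _.
have Emu : Ex PE (fun x => uz x) = mu.
  rewrite ExD; [|by apply: bmfM => //; exact: bmfB|exact: bmfM].
  rewrite ExZ; last exact: bmfB.
  by rewrite ExB// Ex_cst (Ex_uprod n0 T k) ExZ.
apply: (@le_trans _ _ (Ex PE (fun x => expR (- mu) * (1 + mu - uz x)))).
  rewrite ExZ; last exact: bmfB.
  by rewrite ExB// Ex_cst Emu addrK mulr1.
apply: Ex_le => [||x]; first by apply: bmfM => //; exact: bmfB.
  exact: bmf_env.
rewrite /env (_ : - uz x = - mu + (mu - uz x)); last by ring.
rewrite expRD; apply: ler_wpM2l; first exact: expR_ge0.
by apply: le_trans (expR_ge1Dx _); rewrite le_eqVlt; apply/orP; left; apply/eqP; ring.
Qed.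

Lemma envol_gt0 : 0 < envol.
Proof. exact: lt_le_trans (expR_gt0 _) envol_ge. Qed.

Variable a : nat.
Hypothesis am : (a <= m)%N.
Local Notation clam := (@clam R k T n h L m a).

Definition wenv x : R := expR (- (L * a%:R)) * env x.

Lemma bmf_wenv : bmf wenv.
Proof. by apply: bmfM; [exact: bmf_cst|exact: bmf_env]. Qed.

Lemma Ex_wenv : Ex PE wenv = expR (- (L * a%:R)) * envol.
Proof. by rewrite ExZ//; exact: bmf_env. Qed.

Let aR : 0 <= (a%:R : R) <= m%:R. Proof. by rewrite ler0n ler_nat. Qed.

Let abs_bound (z : R) : 0 <= L * m%:R * `|z| + L * a%:R * z <= 2 * m%:R * L * `|z|.
Proof.
case/andP: aR => a0 a1.
have h1 : `|L * a%:R * z| <= L * m%:R * `|z|.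
  by rewrite normrM (ger0_norm (mulr_ge0 L0 a0)) ler_wpM2r// ler_wpM2l.
have -> : 2 * m%:R * L * `|z| = 2 * (L * m%:R * `|z|) by ring.
move: h1; rewrite ler_norml => /andP[]; set A := L * a%:R * z; set B := L * m%:R * `|z|.
by move=> h1 h2; apply/andP; split; lra.
Qed.

(** In [pot] the term - L a z, with z = [zprod x], is at most L m |z|; the remaining constant L a is
    the prefactor of [wenv]. *)
Lemma wenv_le x : 0 <= wenv x <= expR (- rate ccut clam x).
Proof.
rewrite /wenv mulr_ge0 ?expR_ge0//= /env -expRD ler_expR -opprD lerN2.
apply: (le_trans (rate_le_pot h n0 L0 am x)); rewrite /pot.
by have /andP[] := abs_bound (zprod x); lra.
Qed.

Lemma rate_ge0 x : 0 <= rate ccut clam x.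
Proof. by apply: sumr_ge0 => s _; rewrite mulr_ge0// clam_ge0. Qed.

Lemma rounding_ge0 : 0 <= rounding k T h L m a.
Proof.
apply: sumr_ge0 => J _; by rewrite mulr_ge0 ?alpha_ge0// addr_ge0.
Qed.

(** The exponents of [wenv] and of e^-rate differ by at most D = 2 m L |z| + rounding. Since e^-D >=
    1 - D and e^-rate <= 1, the excess of e^-rate over [wenv] is at most D, which is then
    integrated. *)
Lemma free_le : free PE ccut clam <=
  expR (- (L * a%:R)) * envol + (2 * m%:R * L * zdev + rounding k T h L m a).
Proof.
have bz : bmf (fun x : k.-tuple (T.-tuple (n.-tuple TR)) => `|zprod x|) by apply: bmf_norm; exact: bmf_zprod.
have bc c : bmf (fun x : k.-tuple (T.-tuple (n.-tuple TR)) => c) by exact: bmf_cst.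
have bw := bmf_wenv.
apply: (@le_trans _ _ (Ex PE (fun x => wenv x + (2 * m%:R * L * `|zprod x| + rounding k T h L m a)))); last first.
  rewrite ExD//; last by apply: bmfD => //; exact: bmfM.
  rewrite Ex_wenv ExD//; last exact: bmfM.
  by rewrite ExZ// Ex_cst.
apply: Ex_le => [||x].
- by apply: bmf_expN_rate => s; exact: bmf_ccut.
- by apply: bmfD => //; apply: bmfD => //; exact: bmfM.
set D := _ + rounding k T h L m a.
have D0 : 0 <= D by rewrite addr_ge0 ?rounding_ge0// !mulr_ge0.
have r0 := rate_ge0 x; set r := rate _ _ _ in r0 *.
suff : expR (- r) * (1 - D) <= wenv x.
  have : expR (- r) <= 1 by rewrite expR_le1 oppr_le0.
  have : 0 <= expR (- r) by exact: expR_ge0.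
  set e := expR _; move=> e0 e1 hw; nra.
apply: (@le_trans _ _ (expR (- r) * expR (- D))).
  by rewrite ler_wpM2l ?expR_ge0// expR_ge1Dx.
rewrite /wenv /env -!expRD ler_expR.
have := pot_le_rate h n0 L0 am x; rewrite -/r /pot /D.
by have /andP[] := abs_bound (zprod x); lra.
Qed.

End envelope.

Lemma expR_le_1D2x (R : realType) (x : R) : 0 <= x <= 2^-1 -> expR x <= 1 + 2 * x.
Proof.
move=> /andP[x0 x1]; have h : 1 - x <= expR (- x) by exact: expR_ge1Dx.
have e0 := expR_gt0 x; rewrite expRN in h.
have : (1 - x) * expR x <= 1 by rewrite -ler_pdivlMr// mul1r.
nra.
Qed.

Lemma expr1D_le_expR (R : realType) (x : R) n : 0 <= x -> (1 + x) ^+ n <= expR (n%:R * x).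
Proof.
move=> x0; rewrite expRM_natl; apply: lerXn2r; rewrite ?nnegrE ?addr_ge0 ?expR_ge0//.
exact: expR_ge1Dx.
Qed.

(** * Moments close to powers of the mean *)

Section asymptotics.
Context {R : realType}.
Local Notation y0 := (@y0 R).
Local Notation b0 := (@b0 R).

Lemma expr_small (q e : R) : 0 <= q < 1 -> 0 < e -> exists D : nat, q ^+ D <= e.
Proof.
move=> /andP[q0 q1] e0.
have : (fun n => q ^+ n) @ \oo --> (0 : R) by apply: cvg_expr; rewrite ger0_norm.
move=> /cvgrPdist_le/(_ _ e0)[N _ hN]; exists N.
by have := hN N (leqnn N); rewrite sub0r normrN ger0_norm// exprn_ge0.
Qed.

(** Lets the scale B = 2^t dominate constant multiples of its own logarithm. *)
Lemma exists_pow2 (A : nat) : exists t, (A * t.+1 <= 2 ^ t)%N.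
Proof.
pose s := (2 * A)%N; exists (s + s)%N; rewrite expnD.
have hs : (s < 2 ^ s)%N by exact: ltn_expl.
apply: (@leq_trans (s * s.+1)); last by rewrite leq_mul// ltnW.
apply: (@leq_trans (A * (2 * s.+1))).
  by rewrite leq_mul2l mul2n -addnn addnS addSn leqnSn orbT.
by rewrite mulnA [(A * 2)%N]mulnC.
Qed.

(** With ratio B = v (1 + rho) in [mom_le] and rho = e / (2 M), one gets (1 + rho)^N <= e^(e/2) <= 1
    + e. The pair term carries the weight M / ep with ep of order e / M and must stay below a
    multiple of v rho, hence the cube of M in its hypothesis. *)
Lemma moments_close d (E : measurableType d) (P : probability E R) (S : finType)
    (c : S -> E -> bool) (lam : S -> R) (v vmin e err : R) (M : nat) :
  (forall s, bmf (fun x => (c s x)%:R : R)) -> (forall s, 0 <= lam s) ->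
  0 < vmin -> vmin <= v -> v <= 1 -> 0 < e <= 1 -> (0 < M)%N ->
  v <= free P c lam -> free P c lam <= v + err ->
  err * M%:R <= vmin * e / 16 -> pairs P c lam * M%:R ^+ 3 <= vmin ^+ 2 * e ^+ 2 / 64 ->
  forall N, (N <= M)%N -> mom P c lam N <= (1 + e) * v ^+ N.
Proof.
move=> mc lam0 vm0 vmv v1 /andP[e0 e1] M0 vf fe herr hpairs N NM.
have v0 : 0 < v by exact: lt_le_trans vmv.
have MR : 1 <= M%:R :> R by rewrite ler1n.
pose rho : R := e / (2 * M%:R).
have rho0 : 0 < rho by rewrite divr_gt0// mulr_gt0// ltr0n.
have rM : rho * M%:R = e / 2 by rewrite /rho; field; rewrite pnatr_eq0 -lt0n.
have rho1 : rho <= 2^-1 by nra.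
pose ep := rho / 4.
have ep0 : 0 < ep by rewrite divr_gt0.
have M00 : 0 < M%:R :> R by rewrite ltr0n.
have err0 : 0 <= err by have := le_trans vf fe; lra.
have pr0 := pairs_ge0 P c lam0.
have herr' : err <= vmin * rho / 8.
  rewrite -(ler_pM2r M00).
  have -> : vmin * rho / 8 * M%:R = vmin * (rho * M%:R) / 8 by ring.
  rewrite rM; lra.
have hpairs' : ep^-1 * M%:R * pairs P c lam / v <= v * rho / 4.
  rewrite ler_pdivrMr// -mulrA ler_pdivrMl//.
  rewrite -(ler_pM2r (exprn_gt0 2 M00)).
  apply: (@le_trans _ _ (pairs P c lam * M%:R ^+ 3)); first by rewrite !exprS; lra.
  apply: (le_trans hpairs).
  have -> : ep * (v * rho / 4 * v) * M%:R ^+ 2 = v ^+ 2 * (rho * M%:R) ^+ 2 / 16.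
    by rewrite /ep; field.
  rewrite rM; have : vmin ^+ 2 <= v ^+ 2 by apply: lerXn2r => //; rewrite nnegrE ltW.
  have := sqr_ge0 e; set x := vmin ^+ 2; set y := v ^+ 2; set z := e ^+ 2.
  rewrite (_ : (e / 2) ^+ 2 = z / 4); last by rewrite /z; field.
  nra.
have hB : expR ep * free P c lam + ep^-1 * M%:R * pairs P c lam / v <= v * (1 + rho).
  have h1 : expR ep <= 1 + rho / 2.
    apply: le_trans (expR_le_1D2x _) _; first by rewrite ltW//= /ep; lra.
    by rewrite /ep; lra.
  have h2 : expR ep * free P c lam <= (1 + rho / 2) * (v + err).
    by apply: ler_pM => //; rewrite ?expR_ge0//; exact: free_ge0.
  nra.
apply: (le_trans (mom_le mc lam0 v0 vf ep0 hB NM)).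
rewrite exprMn mulrC ler_wpM2r ?exprn_ge0 ?(ltW v0)//.
apply: (le_trans (expr1D_le_expR N (ltW rho0))).
apply: (@le_trans _ _ (expR (e / 2))).
  rewrite ler_expR -rM mulrC ler_wpM2l ?(ltW rho0)// ler_nat//.
apply: le_trans (expR_le_1D2x _) _; first by apply/andP; split; lra.
lra.
Qed.

End asymptotics.

(** * The bodies *)

Lemma continuous_sum (R : realType) (V : topologicalType) (I : Type) (r : seq I)
    (p : pred I) (F : I -> V -> R) : (forall i, continuous (F i)) ->
  continuous (fun x => \sum_(i <- r | p i) F i x).
Proof.
move=> cF; elim: r => [|i r IH] x.
  by rewrite (_ : (fun x => _) = fun=> 0); [exact: cst_continuous|apply/funext => y; rewrite big_nil].
rewrite (_ : (fun x => _) = fun x => (if p i then F i x else 0) + \sum_(i <- r | p i) F i x); last first.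
  by apply/funext => y; rewrite big_cons; case: ifP => //; rewrite add0r.
apply: continuousD; last exact: IH.
by case: (p i); [exact: cF|exact: cst_continuous].
Qed.

Section bodies.
Context {R : realType}.
Variables (k T n h : nat).
Local Notation TR := (measurableTypeR R).
Local Notation PE := (pw (pw (pw (@U01 R) n) T) k).
Local Notation row_type := (k.-tuple (T.-tuple (n.-tuple TR))).
Local Notation cut_type := (cut_type k T n h).
Local Notation ccut := (@ccut R k T n h).
Implicit Types (w : {ffun cut_type -> bool}).

Definition idx : finType := ('I_k * 'I_T * 'I_n)%type.
Local Notation dim := #|idx|.

Definition coords (x : 'rV[R]_dim) r l j : R := x ord0 (enum_rank ((r, l, j) : idx)).

Definition cube : set 'rV[R]_dim := [set x | forall i, `[0, 1]%classic (x ord0 i)].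

Definition body w : set 'rV[R]_dim :=
  cube `&` [set x | forall s, w s -> ~~ is_cut s (coords x)].

Lemma coords_comb (x y : 'rV[R]_dim) (t : R) J (v : {ffun 'I_k * 'I_T -> 'I_n}) :
  wsum J v (coords (t *: x + (1 - t) *: y)) =
  t * wsum J v (coords x) + (1 - t) * wsum J v (coords y).
Proof.
rewrite /wsum !mulr_sumr -big_split/=; apply: eq_bigr => p _.
by rewrite /coords !mxE.
Qed.

Lemma body_convex w (x y : 'rV[R]_dim) (t : R) :
  body w x -> body w y -> 0 <= t <= 1 -> body w (t *: x + (1 - t) *: y).
Proof.
move=> [cx hx] [cy hy] /andP[t0 t1]; split.
  move=> i; have := cx i; have := cy i; rewrite /= !in_itv/= !mxE => /andP[y0 y1] /andP[x0 x1].
  by apply/andP; split; nra.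
move=> s ws; have := hx s ws; have := hy s ws; rewrite /is_cut -!leNgt coords_comb.
set A := wsum _ _ (coords x); set B := wsum _ _ (coords y) => hB hA.
have [AB|BA] := leP A B.
  by apply: le_trans hA; rewrite ler_expR lerN2; nra.
by apply: le_trans hB; rewrite ler_expR lerN2; nra.
Qed.

Lemma wsum_continuous J (v : {ffun 'I_k * 'I_T -> 'I_n}) :
  continuous (fun x : 'rV[R]_dim => wsum J v (coords x)).
Proof.
by apply: continuous_sum => p; exact: coord_continuous.
Qed.

Lemma body_compact w : compact (body w).
Proof.
apply: compact_closedI.
  by apply: (@rV_compact R dim (fun=> `[0, 1]%classic)) => i; exact: segment_compact.
rewrite (_ : [set x | _] = \bigcap_(s in [set s | w s]) [set x | ~~ is_cut s (coords x)]).
  apply: closed_bigI => s _.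
  rewrite (_ : [set x | _] = (fun x => expR (- wsum s.1.1 s.1.2 (coords x))) @^-1` [set y : R | y <= threshold T s.1.1 s.2]).
    apply: preimage_closed; last exact: closed_le.
    move=> x _; apply: continuous_comp; last exact: continuous_expR.
    by apply: continuousN; exact: wsum_continuous.
  by apply/seteqP; split => x /=; rewrite /is_cut -leNgt.
by apply/seteqP; split => x hx s; exact: hx.
Qed.

(** Where all coordinates are at least ln 2, e^-S is at most 2^-(T #|J|), hence below every
    threshold; so no cut reaches the cube [ln 2, 1]^dim. *)
Lemma body_interior w : interior (body w) !=set0.
Proof.
pose l2 : R := ln 2.
have e2 : expR l2 = 2 by rewrite lnK// posrE.
have l21 : l2 < 1.
  rewrite -ltr_expR e2; apply: lt_le_trans (expR_gt1Dx (oner_neq0 R)) _.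
  by rewrite lexx.
have l20 : 0 < l2 by rewrite -expR_gt1 e2 ltr1n.
exists (const_mx ((1 + l2) / 2)); apply/nbhs_ballP; exists ((1 - l2) / 2) => /=.
  by rewrite divr_gt0// subr_gt0.
move=> x hx.
have hx' i : l2 <= x ord0 i <= 1.
  have : ball ((1 + l2) / 2) ((1 - l2) / 2) (x ord0 i).
    by have [_ /(_ ord0 i)] := hx; rewrite mxE.
  by rewrite -ball_normE/= ltr_norml => /andP[h1 h2]; apply/andP; split; lra.
split.
  move=> i; have /andP[h1 h2] := hx' i; rewrite /= in_itv/= h2 andbT.
  by apply: le_trans h1; exact: ltW.
move=> s _; rewrite /is_cut -leNgt /threshold le_max; apply/orP; right.
rewrite -(@prod_in_exp R k T) pair_bigA/=.
rewrite -[wsum _ _ _]mulr1 expR_wsum pair_bigA/=; apply: ler_prod => -[r l] _ /=.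
rewrite mulr1; case: ifP => _; last by rewrite ler01 lexx.
rewrite expR_ge0/= -e2 -expRN ler_expR lerN2.
by have /andP[] := hx' (enum_rank ((r, l, s.1.2 (r, l)) : idx)).
Qed.

Lemma body_convex_body w : convex_body (body w).
Proof.
split; [exact: body_compact|exact: body_interior|].
by move=> x y t; exact: body_convex.
Qed.

End bodies.

Lemma prod_unit (R : realType) (F : unit -> R) : \prod_i F i = F tt.
Proof. by rewrite (big_pred1 tt)// => -[]. Qed.

Lemma mem_indic_prod (R : realType) (I : finType) (W : Type) (phi : W -> I -> R) (a b : I -> R) w :
  \1_(phi @^-1` box (a, b)) w = \prod_i (a i <= phi w i <= b i)%R%:R :> R.
Proof.
rewrite indicE prod_natr_bool; congr ((_ : bool)%:R).
apply/idP/forallP => [/set_mem h i|h]; first exact: h.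
by apply/mem_set => i; exact: h.
Qed.

Section volumes.
Context {R : realType}.
Variables (k T n h : nat).
Local Notation TR := (measurableTypeR R).
Local Notation PE := (pw (pw (pw (@U01 R) n) T) k).
Local Notation row_type := (k.-tuple (T.-tuple (n.-tuple TR))).
Local Notation cut_type := (cut_type k T n h).
Local Notation ccut := (@ccut R k T n h).
Local Notation idx := (idx k T n).
Local Notation dim := #|idx|.
Implicit Types (w : {ffun cut_type -> bool}).

Definition cube_point (x : row_type) (i : 'I_dim) : R :=
  let p := enum_val i in crd x p.1.1 p.1.2 p.2.

Lemma coords_point (x : row_type) : coords (\row_i cube_point x i) = crd x.
Proof.
apply/funext => r; apply/funext => l; apply/funext => j.
by rewrite /coords mxE /cube_point enum_rankK.
Qed.

Lemma bmf_crd r l j : bmf (fun x : row_type => crd x r l j).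
Proof.
exact: (bmf_tnth r (bmf_tnth l (bmf_tnth j bmf_clamp))).
Qed.

Lemma point_in (x : row_type) i : 0 <= cube_point x i <= 1.
Proof. by rewrite /cube_point/= /crd clamp_ge0 clamp_le1. Qed.

Lemma body_point w (x : row_type) : body w (\row_i cube_point x i) <-> kept ccut w x.
Proof.
split=> [[_ hx]|/forallP hx].
  apply/forallP => s; apply/implyP => ws; have := hx s ws.
  by rewrite coords_point.
split; first by move=> i /=; rewrite mxE in_itv/= point_in.
by move=> s ws; rewrite coords_point; have := hx s; rewrite ws.
Qed.

Lemma prod_idx (F : 'I_dim -> R) :
  \prod_i F i = \prod_r \prod_l \prod_j F (enum_rank ((r, l, j) : idx)).
Proof.
rewrite (reindex (@enum_rank idx)); last exact/onW_bij/enum_rank_bij.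
by rewrite pair_bigA pair_bigA/=; apply: eq_bigr => -[[r l] j].
Qed.

Lemma bmf_itv (a b : R) : bmf (fun v : TR => (a <= clamp v <= b)%R%:R : R).
Proof.
rewrite (_ : (fun v => _) = \1_(@clamp R @^-1` `[a, b])).
  by apply: bmf_indic; rewrite -[X in measurable X]setTI; exact: measurable_clamp.
apply/funext => x; rewrite indicE; congr ((_ : bool)%:R).
by apply/idP/idP => [hx|/set_mem]; [apply/mem_set|]; rewrite /= in_itv.
Qed.

Lemma bmf_point_box (a b : 'I_dim -> R) :
  bmf (fun x => \prod_i (a i <= cube_point x i <= b i)%R%:R : R).
Proof.
apply: bmf_prod => i _.
exact: (bmf_tnth _ (bmf_tnth _ (bmf_tnth _ (bmf_itv (a i) (b i))))).
Qed.

Lemma Ex_point_box (a b : 'I_dim -> R) :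
  (forall i, 0 <= a i <= b i) -> (forall i, b i <= 1) ->
  Ex PE (fun x => \prod_i (a i <= cube_point x i <= b i)%R%:R) = \prod_i (b i - a i).
Proof.
move=> hab hb; pose e r l j := enum_rank ((r, l, j) : idx).
pose F r l j (v : TR) : R := (a (e r l j) <= clamp v <= b (e r l j))%R%:R.
have bF r l j : bmf (F r l j) by exact: bmf_itv.
rewrite (_ : (fun x => _) = fun x => \prod_r \prod_l \prod_j F r l j (tnth (tnth (tnth x r) l) j)); last first.
  apply/funext => x; rewrite prod_idx; apply: eq_bigr => r _; apply: eq_bigr => l _.
  by apply: eq_bigr => j _; rewrite /cube_point enum_rankK.
rewrite Ex_pw3_prod// prod_idx; apply: eq_bigr => r _; apply: eq_bigr => l _.
apply: eq_bigr => j _.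
exact: Ex_clamp_itv.
Qed.

Lemma measurable_point i : measurable_fun setT (fun x => cube_point x i).
Proof. by have [] := bmf_crd (enum_val i).1.1 (enum_val i).1.2 (enum_val i).2. Qed.

Lemma point_box_prob (a b : 'I_dim -> R) :
  (forall i, 0 <= a i <= b i) -> (forall i, b i <= 1) ->
  PE (cube_point @^-1` box (a, b)) = box_vol (a, b).
Proof.
move=> hab hb; rewrite -Ex_indic; last first.
  by apply: coord_sigma_measurable; [exact: measurable_point|exact: coord_sigma_box].
rewrite /box_vol -Ex_point_box//; congr (Ex _ _)%:E.
by apply/funext => x; exact: mem_indic_prod.
Qed.

Lemma row_mx_continuous (x : 'I_dim -> R) (e : R) : 0 < e -> exists2 r : R, 0 < r &
  forall y : 'I_dim -> R, (forall i, `|y i - x i| < r) ->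
    ball (\row_i x i : 'rV[R]_dim) e (\row_i y i).
Proof.
move=> e0; exists e => // y hy; split => // i j.
by rewrite !mxE -ball_normE/= distrC.
Qed.

Lemma volume_body w : volume (body w) = (kvol PE ccut w)%:E.
Proof.
rewrite /volume (@leb_outer_repr _ _ _ _ PE cube_point measurable_point point_box_prob); last 2 first.
- apply: (@coord_sigma_closed _ _ _ (fun x : 'I_dim -> R => \row_i x i)).
    exact: row_mx_continuous.
  by apply: compact_closed; [exact: norm_hausdorff|exact: body_compact].
- by move=> x [cx _] i; have := cx i; rewrite /= mxE in_itv.
have bk := mkept (@bmf_ccut R k T n h) w.
rewrite /kvol (_ : (fun x => _) = \1_([set x | kept ccut w x])).
  rewrite Ex_indic.
    by congr (PE _); apply/seteqP; split => x /=; rewrite body_point.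
  have := (proj1 bk) measurableT _ (measurable_itv `[1, +oo[); rewrite setTI.
  congr measurable; apply/seteqP; split => x /=; rewrite in_itv/= andbT; case: kept => //=.
  by rewrite ler10.
apply/funext => x; rewrite indicE; congr ((_ : bool)%:R).
by apply/idP/idP => [hx|/set_mem//]; exact/mem_set.
Qed.

Variable N : nat.
Local Notation PD := (pprod (pw PE N) (@U01 R)).
Local Notation coord_type := ('I_N * 'I_dim + unit)%type.

Definition sample (z : N.-tuple row_type * TR) (i : coord_type) : R :=
  match i with inl p => cube_point (tnth z.1 p.1) p.2 | inr _ => clamp z.2 end.

Definition unpack (y : coord_type -> R) : 'M[R]_(N, dim) * R :=
  (\matrix_(a, i) y (inl (a, i)), y (inr tt)).

Lemma measurable_sample i : measurable_fun setT (fun z => sample z i).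
Proof.
case: i => [[a i]|[]] /=.
  apply: (measurableT_comp (measurable_point i)).
  exact: (measurableT_comp (@measurable_tnth _ row_type N a) measurable_fst).
apply: (measurableT_comp measurable_clamp); exact: measurable_snd.
Qed.

Lemma sample_box_prob (a b : coord_type -> R) :
  (forall i, 0 <= a i <= b i) -> (forall i, b i <= 1) ->
  PD (sample @^-1` box (a, b)) = box_vol (a, b).
Proof.
move=> hab hb; rewrite -Ex_indic; last first.
  by apply: coord_sigma_measurable; [exact: measurable_sample|exact: coord_sigma_box].
rewrite /box_vol big_sumType prod_unit/=.
rewrite [X in X * _](_ : _ = \prod_(c < N) \prod_(i < dim) (b (inl (c, i)) - a (inl (c, i)))); last first.
  by rewrite pair_bigA; apply: eq_bigr => -[c i].
pose f c (x : row_type) : R := \prod_i (a (inl (c, i)) <= cube_point x i <= b (inl (c, i)))%R%:R.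
have bf c : bmf (f c) by exact: bmf_point_box.
have bfp : bmf (fun X : N.-tuple row_type => \prod_c f c (tnth X c)).
  by apply: bmf_prod => c _; exact: (bmf_tnth c (bf c)).
pose g (v : TR) : R := (a (inr tt) <= clamp v <= b (inr tt))%R%:R.
have bg : bmf g by exact: bmf_itv.
rewrite (_ : \1_(_ @^-1` _) = fun z => (\prod_c f c (tnth z.1 c)) * g z.2); last first.
  apply/funext => z; rewrite mem_indic_prod big_sumType prod_unit/=; congr (_ * _).
  by rewrite pair_bigA; apply: eq_bigr => -[c i].
rewrite (Ex_product (pw PE N) (@U01 R) bfp bg) (Ex_pw_prod _ bf).
rewrite (_ : Ex U01 g = b (inr tt) - a (inr tt)); last exact: Ex_clamp_itv.
by congr (_ * _)%:E; apply: eq_bigr => c _; exact: Ex_point_box.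
Qed.

Lemma unpack_continuous (x : coord_type -> R) (e : R) : 0 < e -> exists2 r : R, 0 < r &
  forall y : coord_type -> R, (forall i, `|y i - x i| < r) -> ball (unpack x) e (unpack y).
Proof.
move=> e0; exists e => // y hy; split.
  by split => // i j; rewrite !mxE -ball_normE/= distrC.
by rewrite -ball_normE/= distrC.
Qed.

Lemma row_unpack_continuous a (x : coord_type -> R) (e : R) : 0 < e -> exists2 r : R, 0 < r &
  forall y : coord_type -> R, (forall i, `|y i - x i| < r) ->
    ball (row a (unpack x).1) e (row a (unpack y).1).
Proof.
move=> e0; exists e => // y hy; split => // i j.
by rewrite !mxE -ball_normE/= distrC.
Qed.

Variable f : 'M[R]_(N, dim) * R -> R.
Hypothesis bf : borel_fun f.

Definition accept (lo hi : R) (z : N.-tuple row_type * TR) : R :=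
  (lo <= f (unpack (sample z)) <= hi)%R%:R.

Lemma coord_sigma_accept (lo hi : R) :
  coord_sigma [set y : coord_type -> R | (lo <= f (unpack y) <= hi)%R].
Proof.
rewrite (_ : [set y | _] = ~` (unpack @^-1` (f @^-1` (~` `[lo, hi])))).
  apply: coord_sigmaC; apply: coord_sigma_borel; first exact: unpack_continuous.
  by apply: bf; apply: closed_openC; exact: itv_closed.
rewrite preimage_setC preimage_setC setCK.
by apply/seteqP; split => y /=; rewrite in_itv.
Qed.

Lemma bmf_accept lo hi : bmf (accept lo hi).
Proof.
rewrite (_ : accept lo hi = \1_(sample @^-1` [set y : coord_type -> R | (lo <= f (unpack y) <= hi)%R])).
  apply: bmf_indic; apply: coord_sigma_measurable; first exact: measurable_sample.
  exact: coord_sigma_accept.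
apply/funext => z; rewrite indicE; congr ((_ : bool)%:R).
by apply/idP/idP => [hx|/set_mem//]; exact/mem_set.
Qed.

(** Turns the outer measure in [correct_with_prob] into an expectation over N independent points and
    a seed. *)
Lemma success_prob w (lo hi : R) :
  leb_outer (sample_seed_set [set Xu : 'M[R]_(N, dim) * R |
     (forall a : 'I_N, body w (row a Xu.1)) /\ 0 <= Xu.2 <= 1 /\ lo <= f Xu <= hi]%R) =
  (Ex PD (fun z => (\prod_a (kept ccut w (tnth z.1 a))%:R) * accept lo hi z))%:E.
Proof.
set A := sample_seed_set _.
have cA : coord_sigma A.
  rewrite (_ : A = [set y | forall a, ((fun y : coord_type -> R => row a (unpack y).1) @^-1` (body w)) y] `&`
     ([set y | forall i : unit, ((fun y : coord_type -> R => y (inr tt) : R^o) @^-1` `[0, 1]) y] `&`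
      [set y : coord_type -> R | (lo <= f (unpack y) <= hi)%R])).
    apply: coord_sigmaI; [|apply: coord_sigmaI; last exact: coord_sigma_accept].
      apply: (@coord_sigma_forall _ _ 'I_N (fun a => (fun y : coord_type -> R => row a (unpack y).1) @^-1` body w)) => a.
      apply: coord_sigma_closed; first exact: row_unpack_continuous.
      by apply: compact_closed; [exact: norm_hausdorff|exact: body_compact].
    apply: (@coord_sigma_forall _ _ unit (fun=> (fun y : coord_type -> R => y (inr tt) : R^o) @^-1` `[0, 1])) => _.
    apply: coord_sigma_closed; last exact: itv_closed.
    by move=> x e e0; exists e => // y hy; rewrite -ball_normE/= distrC.
  apply/seteqP; split => y /=; rewrite in_itv/=; first by move=> [h1 [h2 h3]]; split.
  by move=> [h1 [h2 h3]]; split => //; split => //; exact: h2.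
have AC : A `<=` box (fun=> 0, fun=> 1).
  move=> y /= [hK [hu _]] [[a i]|[]] //=.
  by have [ca _] := hK a; have := ca i; rewrite /= !mxE in_itv.
rewrite (@leb_outer_repr _ _ _ _ PD sample measurable_sample sample_box_prob A cA AC).
rewrite -Ex_indic; last by apply: coord_sigma_measurable => //; exact: measurable_sample.
congr (Ex _ _)%:E; apply/funext => z.
rewrite indicE prod_natr_bool /accept -natrM mulnb; congr ((_ : bool)%:R).
have rowE a : row a (unpack (sample z)).1 = \row_i cube_point (tnth z.1 a) i.
  by apply/rowP => i; rewrite !mxE.
apply/idP/andP => [/set_mem [hK [_ hf]]|[/forallP hK hf]].
  split => //; apply/forallP => a; apply/body_point.
  by rewrite -rowE; exact: hK.
apply/mem_set; split; last by rewrite /= clamp_ge0 clamp_le1.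
by move=> a; rewrite -/(unpack _) rowE; apply/body_point/hK.
Qed.

End volumes.

(** * Choice of the parameters *)

Lemma exists_nat_ge (R : realType) (x : R) : exists A : nat, x <= A%:R.
Proof.
exists (Num.bound `|x|); apply: (le_trans (ler_norm x)).
exact/ltW/archi_boundP.
Qed.

Lemma div_swap_le (R : realType) (x s d B : R) : 0 < B -> 0 < d -> 0 < s ->
  x * s / d <= B -> x / B <= d / s.
Proof.
move=> B0 d0 s0; rewrite ler_pdivrMr// => h.
by rewrite ler_pdivrMr// mulrAC ler_pdivlMr// [d * B]mulrC.
Qed.

Lemma nat_upper5 (a1 a2 a3 a4 a5 : nat) :
  exists A, [/\ a1 <= A, a2 <= A, a3 <= A, a4 <= A & a5 <= A]%N.
Proof. by exists (a1 + a2 + a3 + a4 + a5)%N; split; lia. Qed.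

Lemma mul3_lt (D t k : nat) : ((D * t * k).+1 <= (D * k).+1 * t.+1)%N.
Proof. by rewrite mulSn mulnS mulnAC; lia. Qed.

Section parameters.
Context {R : realType}.
Local Notation y0 := (@y0 R).
Local Notation b0 := (@b0 R).

(** With T = D t and B = 2^t, geometric decay in T is polynomial decay in B. *)
Lemma pow_geom (q : R) D t j : 0 <= q -> q ^+ D <= 2^-1 ^+ j ->
  q ^+ (D * t) <= ((2 ^ t)%:R^-1) ^+ j.
Proof.
move=> q0 hq; have -> : (2 ^ t)%:R^-1 ^+ j = (2^-1 ^+ j) ^+ t :> R.
  by rewrite natrX -exprVn -!exprM mulnC.
by rewrite exprM; apply: lerXn2r; rewrite ?nnegrE ?exprn_ge0.
Qed.

(** Blocks of size B^4 make the variance of a group at most B^-2, so each of the k factors has mean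
    deviation at most B^-1. *)
Lemma zdev_le k T B : (0 < B)%N -> (8 * T <= B)%N -> zdev k T (B ^ 4) <= (B%:R^-1 : R) ^+ k.
Proof.
move=> B0 TB; have n0 : (0 < B ^ 4)%N by rewrite expn_gt0 B0.
have BR : 1 <= B%:R :> R by rewrite ler1n.
have BR0 : 0 < B%:R :> R by rewrite ltr0n.
have th0 : 0 < B%:R^-1 :> R by rewrite invr_gt0.
apply: (le_trans (Ex_zprod n0 T k th0)).
have h1 : T%:R * (4 / (B ^ 4)%:R) <= B%:R^-1 ^+ 2 / 2 :> R.
  rewrite natrX mulrA ler_pdivrMr ?exprn_gt0//.
  have -> : B%:R^-1 ^+ 2 / 2 * B%:R ^+ 4 = B%:R ^+ 2 / 2 :> R by field; rewrite lt0r_neq0.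
  have : 8 * T%:R <= B%:R :> R by rewrite -natrM ler_nat.
  nra.
have ib : 0 <= (B%:R^-1 ^+ 2 : R) <= 1.
  by rewrite sqr_ge0 exprn_ile1 ?(ltW th0)// invf_le1.
have h0 : 0 <= T%:R * (4 / (B ^ 4)%:R) :> R by rewrite mulr_ge0// divr_ge0.
have h2 : (1 + 4 / (B ^ 4)%:R) ^+ T <= 1 + B%:R^-1 ^+ 2 :> R.
  apply: (le_trans (expr1D_le_expR T _)); first by rewrite divr_ge0.
  apply: (le_trans (expR_le_1D2x _)); first by rewrite h0; case/andP: ib => _ i1; lra.
  lra.
have h3 : 1 <= (1 + 4 / (B ^ 4)%:R) ^+ T :> R.
  by rewrite exprn_ege1// lerDl divr_ge0.
have h4 : B%:R^-1^-1 * ((1 + 4 / (B ^ 4)%:R) ^+ T - 1) <= B%:R^-1 :> R.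
  rewrite invrK; apply: (@le_trans _ _ (B%:R * B%:R^-1 ^+ 2)).
    by rewrite ler_pM2l//; lra.
  by rewrite expr2 mulrA divff ?mul1r// lt0r_neq0.
apply: lerXn2r; rewrite ?nnegrE ?(ltW th0)//.
  by rewrite divr_ge0// addr_ge0 ?(ltW th0)// mulr_ge0 ?subr_ge0// invrK ltW.
lra.
Qed.

(** The parameters precede [N], because the sample size is known only once the dimension is. All of
    them are expressed through one scale B = 2^t. *)
Lemma parameters (L e kappa c : R) (m : nat) : 0 <= L -> 0 < e <= 1 -> 0 < kappa ->
  exists k T n h : nat, (0 < n)%N /\
  forall N : nat, N%:R <= c * (#|idx k T n|%:R `^ kappa) ->
  forall a, (a <= m)%N -> forall j, (j <= N.+2)%N ->
  mom (pw (pw (pw (@U01 R) n) T) k) (@ccut R k T n h) (@clam R k T n h L m a) j <=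
    (1 + e) * (expR (- (L * a%:R)) * envol k T n L m) ^+ j.
Proof.
move=> L0 he kap0; have /andP[e0 e1] := he.
have [K0 hK0] := exists_nat_ge kappa.
(* As dim <= B^5, the sample size satisfies N + 2 <= B^kp, the extra unit in [kp] absorbing |c| + 2.
   One more unit in [k] makes the error B^-k, multiplied by N + 2, of order 1/B. *)
pose kp := (5 * K0).+1; pose k := kp.+1.
have y2 := @y0_gt_half R; have y0p := @y0_gt0 R.
have q1b : 0 <= ((2 * y0)^-1 : R) < 1.
  by rewrite invr_ge0 invf_lt1 ?mulr_gt0//; apply/andP; split; lra.
have q2b : 0 <= (b0 ^+ 2 / y0 : R) < 1.
  by rewrite divr_ge0 ?sqr_ge0 ?(ltW y0p)//= ltr_pdivrMr// mul1r b0_sqr_lt_y0.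
have i2 j : 0 < 2^-1 ^+ j :> R by rewrite exprn_gt0.
have [D1 hD1] := expr_small q1b (i2 k).
(* The pair rate is multiplied by (N + 2)^3 <= B^(3 kp) and by h + 1 <= B; the exponent leaves a
   factor 1/B. *)
have [D2 hD2] := expr_small q2b (i2 (3 * kp + 2)%N).
have shrink (q : R) D D' : 0 <= q < 1 -> q ^+ (D + D') <= q ^+ D.
  by move=> /andP[q0 q1]; apply: ler_wiXn2l; rewrite ?(ltW q1)// leq_addr.
pose D := (D1 + D2)%N.
have hD1' : (2 * y0)^-1 ^+ D <= 2^-1 ^+ k by apply: le_trans hD1; exact: shrink.
have hD2' : (b0 ^+ 2 / y0) ^+ D <= 2^-1 ^+ (3 * kp + 2).
  by apply: le_trans hD2; rewrite /D addnC; exact: shrink.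
have Lm0 : 0 <= L * m%:R by rewrite mulr_ge0.
(* A lower bound for all the mean volumes, from [envol_ge] with [zdev] at most 1. It does not
   involve t, so B may be chosen after it. *)
pose vmin : R := expR (- (L * m%:R)) * expR (- (L * m%:R * (2 ^+ k - 1) + L * m%:R)).
have vm0 : 0 < vmin by rewrite mulr_gt0 ?expR_gt0.
pose c1 : R := 2 * m%:R * L + 2 ^+ k * (4 * m%:R * L).
pose c2 : R := 2 ^+ k * (2 * m%:R * L).
have [A1 hA1] := exists_nat_ge (c1 * 16 / (vmin * e)).
have [A2 hA2] := exists_nat_ge (c2 * 64 / (vmin ^+ 2 * e ^+ 2)).
have [A3 hA3] := exists_nat_ge (`|c| + 2).
(* The first two bounds make the errors c1 / B and c2 / B small enough, the third absorbs |c| + 2,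
   and the last two give 8 T <= B and h < B. *)
have [A [AA1 AA2 AA3 AA4 AA5]] := nat_upper5 A1 A2 A3 (8 * D) (D * k).+1.
have [t ht] := exists_pow2 A.
pose B := (2 ^ t)%N; pose T := (D * t)%N; pose h := (T * k)%N.
have B0 : (0 < B)%N by rewrite expn_gt0.
have AB x : (x <= A)%N -> (x * t.+1 <= B)%N.
  by move=> xA; apply: leq_trans ht; rewrite leq_mul2r xA orbT.
have AB1 x : (x <= A)%N -> (x <= B)%N.
  by move=> xA; apply: leq_trans (AB _ xA); rewrite leq_pmulr.
have TB : (8 * T <= B)%N.
  apply: leq_trans (AB (8 * D)%N AA4).
  by rewrite /T (mulnA 8 D t) leq_mul ?leqnSn.
have hB : (h.+1 <= B)%N.
  by apply: leq_trans (AB (D * k).+1 AA5); exact: mul3_lt.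
have BA1 : A1%:R <= B%:R :> R by rewrite ler_nat AB1.
have BA2 : A2%:R <= B%:R :> R by rewrite ler_nat AB1.
have BA3 : A3%:R <= B%:R :> R by rewrite ler_nat AB1.
have n0 : (0 < B ^ 4)%N by rewrite expn_gt0 B0.
have BR : 1 <= B%:R :> R by rewrite ler1n.
have BR0 : 0 < B%:R :> R by rewrite ltr0n.
exists k, T, (B ^ 4)%N, h; split => // N hN a am j hj.
pose M := N.+2.
have hM : M%:R <= B%:R ^+ kp :> R.
  have hdim : #|idx k T (B ^ 4)|%:R <= B%:R ^+ 5 :> R.
    rewrite -natrX ler_nat /idx !card_prod !card_ord [(B ^ 5)%N]expnS leq_mul//.
    by rewrite mulnC; exact: leq_trans (leqnSn _) hB.
  have hpow : #|idx k T (B ^ 4)|%:R `^ kappa <= B%:R ^+ (5 * K0).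
    apply: (@le_trans _ _ ((B%:R ^+ 5) `^ kappa)).
      by apply: ge0_ler_powR; rewrite ?nnegrE ?(ltW kap0)// exprn_ge0.
    apply: (@le_trans _ _ ((B%:R ^+ 5) `^ K0%:R)).
      by apply: ler_powR => //; rewrite exprn_ege1.
    by rewrite powR_mulrn ?exprn_ge0// exprM.
  have hB1 : 1 <= B%:R ^+ (5 * K0) :> R by rewrite exprn_ege1.
  have h1 : N%:R <= `|c| * B%:R ^+ (5 * K0).
    apply: (le_trans hN); apply: (@le_trans _ _ (`|c| * (#|idx k T (B ^ 4)|%:R `^ kappa))).
      by rewrite ler_wpM2r ?powR_ge0// ler_norm.
    by rewrite ler_wpM2l.
  rewrite /M -addn2 natrD /kp exprS.
  apply: (@le_trans _ _ ((`|c| + 2) * B%:R ^+ (5 * K0))); first by rewrite mulrDl lerD// ler_peMr.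
  by rewrite ler_wpM2r ?exprn_ge0 ?(ltW BR0)// (le_trans hA3).
have hz : zdev k T (B ^ 4) <= (B%:R^-1 : R) ^+ k := zdev_le k B0 TB.
have iB0 : 0 <= B%:R^-1 :> R by rewrite invr_ge0 ltW.
have iB1 : B%:R^-1 <= 1 :> R by rewrite invf_le1.
have hz1 : zdev k T (B ^ 4) <= 1 :> R by apply: (le_trans hz); rewrite exprn_ile1.
have ev_ge : expR (- (L * m%:R * (2 ^+ k - 1) + L * m%:R)) <= envol k T (B ^ 4) L m.
  apply: le_trans (envol_ge k T n0 L m); rewrite ler_expR lerN2 lerD2l.
  by rewrite ler_piMr.
have ev0 := envol_gt0 k T n0 L m.
set v := expR (- (L * a%:R)) * _.
have aR : L * a%:R <= L * m%:R by rewrite ler_wpM2l// ler_nat.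
have vv : vmin <= v.
  by rewrite /vmin /v ler_pM ?expR_ge0// ler_expR lerN2.
have v1 : v <= 1.
  rewrite /v -(Ex_wenv k T (B ^ 4) L m a) -[leRHS](Ex_cst (pw (pw (pw (@U01 R) (B ^ 4)) T) k)).
  apply: Ex_le => [||x]; [exact: bmf_wenv|exact: bmf_cst|].
  have /andP[_ hw] := wenv_le h n0 L0 am x; apply: (le_trans hw).
  by rewrite expR_le1 oppr_le0 rate_ge0.
have mc s : bmf (fun x => (@ccut R k T (B ^ 4) h s x)%:R : R) by exact: bmf_ccut.
have lam0 : forall s, 0 <= @clam R k T (B ^ 4) h L m a s by exact: clam_ge0.
set err := 2 * m%:R * L * zdev k T (B ^ 4) + rounding k T h L m a.
have MB3 : M%:R ^+ 3 <= B%:R ^+ (3 * kp) :> R.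
  by rewrite mulnC exprM; apply: lerXn2r; rewrite ?nnegrE ?exprn_ge0 ?(ltW BR0).
have mL i : 0 <= i%:R * m%:R * L by rewrite !mulr_ge0.
apply: (@moments_close R _ _ _ _ _ _ v vmin e err M mc lam0 vm0 vv v1 he (ltn0Sn _) _ _ _ _ j hj).
- rewrite /v -(Ex_wenv k T (B ^ 4) L m a); apply: Ex_le => [||x]; first exact: bmf_wenv.
    exact: bmf_expN_rate.
  by have /andP[] := wenv_le h n0 L0 am x.
- exact: free_le.
- have hr : rounding k T h L m a <= 2 ^+ k * (4 * m%:R * L * B%:R^-1 ^+ k).
    apply: (le_trans (rounding_le L0 am (leqnn h))).
    apply: ler_wpM2l; first exact: exprn_ge0.
    apply: ler_wpM2l; first exact: mL.
    by apply: pow_geom => //; case/andP: q1b.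
  have herr : err <= c1 * B%:R^-1 ^+ k.
    rewrite /err /c1 [leRHS]mulrDl; apply: lerD; first by rewrite ler_wpM2l ?mulr_ge0.
    by apply: (le_trans hr); rewrite !mulrA.
  have c10 : 0 <= c1 by apply: addr_ge0; [exact: mL|apply: mulr_ge0; [exact: exprn_ge0|exact: mL]].
  apply: (@le_trans _ _ (c1 * B%:R^-1 ^+ k * B%:R ^+ kp)).
    apply: ler_pM => //; rewrite /err addr_ge0 ?rounding_ge0//.
    by rewrite !mulr_ge0// zdev_ge0.
  have -> : c1 * B%:R^-1 ^+ k * B%:R ^+ kp = c1 / B%:R.
    have x0 : B%:R ^+ kp != 0 :> R by rewrite expf_neq0// lt0r_neq0.
    rewrite /k exprS exprVn; move: x0; set x := _ ^+ kp => x0.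
    by field; rewrite x0 lt0r_neq0.
  by apply: div_swap_le (le_trans hA1 BA1) => //; exact: mulr_gt0.
- have hp : pairs (pw (pw (pw (@U01 R) (B ^ 4)) T) k) (@ccut R k T (B ^ 4) h) (@clam R k T (B ^ 4) h L m a) <=
      B%:R * (c2 * B%:R^-1 ^+ (3 * kp + 2)).
    apply: (le_trans (@pairs_le R k T (B ^ 4) h n0 L m L0 a am)); apply: ler_pM => //.
    - apply: mulr_ge0; [exact: exprn_ge0|apply: mulr_ge0; first exact: mL].
      by apply: exprn_ge0; case/andP: q2b.
    - by rewrite ler_nat.
    rewrite /c2 -[leRHS]mulrA; apply: ler_wpM2l; first exact: exprn_ge0.
    apply: ler_wpM2l; first exact: mL.
    by apply: pow_geom => //; case/andP: q2b.
  apply: (@le_trans _ _ (B%:R * (c2 * B%:R^-1 ^+ (3 * kp + 2)) * B%:R ^+ (3 * kp))).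
    by apply: ler_pM => //; exact: pairs_ge0.
  have -> : B%:R * (c2 * B%:R^-1 ^+ (3 * kp + 2)) * B%:R ^+ (3 * kp) = c2 / B%:R.
    have x0 : B%:R ^+ (3 * kp) != 0 :> R by rewrite expf_neq0// lt0r_neq0.
    rewrite exprD !exprVn; move: x0; set x := _ ^+ (3 * kp) => x0.
    by field; rewrite x0 lt0r_neq0.
  by apply: div_swap_le (le_trans hA2 BA2) => //; apply: mulr_gt0; exact: exprn_gt0.
Qed.

End parameters.

Lemma sum_disjoint_le1 (R : realType) m (q : 'I_m -> bool) :
  (forall a b, a != b -> q a -> ~~ q b) -> \sum_a (q a)%:R <= 1 :> R.
Proof.
move=> hq; have [/existsP[a qa]|] := boolP [exists a, q a].
  rewrite (bigD1 a)//= qa big1 ?addr0// => b ba.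
  by rewrite (negPf (hq a b _ qa))// eq_sym.
by rewrite negb_exists => /forallP hn; rewrite big1// => a _; rewrite (negPf (hn a)).
Qed.

(** Successive values v differ by a factor e^-L, and 4 C^2 e^-L <= L e^-L < 1. *)
Lemma intervals_disjoint (R : realType) (L C ev y : R) (a b : nat) :
  0 < C -> 4 * C ^+ 2 <= L -> 0 < ev -> a != b ->
  let v c := expR (- (L * c%:R)) * ev in
  v a / (2 * C) <= y <= 2 * C * v a -> ~~ (v b / (2 * C) <= y <= 2 * C * v b).
Proof.
move=> C0 CL ev0 ab v.
have L0 : 0 <= L by apply: le_trans CL; rewrite mulr_ge0 ?sqr_ge0.
wlog ltab : a b ab / (a < b)%N.
  move=> H ha; have [lt|lt|e] := ltngtP a b; first exact: H ha.
    apply/negP => hb; have := H b a _ lt hb; rewrite eq_sym ab => /(_ isT).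
    by rewrite ha.
  by rewrite e eqxx in ab.
move=> /andP[h1 _]; rewrite negb_and; apply/orP; right; rewrite -ltNge.
apply: lt_le_trans h1; rewrite ltr_pdivlMr ?mulr_gt0//.
have -> : 2 * C * v b * (2 * C) = 4 * C ^+ 2 * v b by ring.
have va0 : 0 < v a by rewrite mulr_gt0 ?expR_gt0.
apply: (@le_lt_trans _ _ (L * (expR (- L) * v a))).
  apply: ler_pM CL _; first by rewrite mulr_ge0 ?sqr_ge0.
    by rewrite mulr_ge0 ?expR_ge0// ltW.
  rewrite /v/= mulrA -expRD; apply: ler_wpM2r; first exact: ltW.
  rewrite ler_expR -opprD lerN2 -{1}[L]mulr1 -mulrDr ler_wpM2l//.
  by rewrite addrC natr1 ler_nat.
rewrite mulrA -[ltRHS]mul1r ltr_pM2r// expRN ltr_pdivrMr ?expR_gt0// mul1r.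
apply: lt_le_trans (expR_ge1Dx L); lra.
Qed.


Unset Implicit Arguments.

Theorem theorem1 (R : realType) :
  ~ (exists (C p kappa : R), [/\ 0 < C, 0 < p & 0 < kappa] /\
      exists c : R, forall n : nat,
        exists (N : nat) (f : 'M[R]_(N, n) * R -> R),
          [/\ N%:R <= c * (n%:R `^ kappa), borel_fun f & correct_with_prob f C p]).
Proof.
move=> [C [p [kappa [[C0 p0 kap0] [c alg]]]]].
pose L : R := 4 * C ^+ 2.
have L0 : 0 <= L by rewrite mulr_ge0 ?sqr_ge0.
have [m0 hm0] := exists_nat_ge (4 / p).
pose m := m0.+1; have hm : 4 < m%:R * p.
  by rewrite -ltr_pdivrMr//; apply: (le_lt_trans hm0); rewrite ltr_nat.
(* The bound 1/16 gives 1 - 8 e >= 1/2, and p/8 gives p/2 - e >= 3p/8; summed over m events with m p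
   > 4 this exceeds 3/2. *)
pose e : R := Num.min 16^-1 (p / 8).
have e0 : 0 < e by rewrite lt_min invr_gt0 ltr0n divr_gt0.
have e16 : e <= 16^-1 by rewrite ge_min lexx.
have ep : e <= p / 8 by rewrite ge_min lexx orbT.
have e1 : 0 < e <= 1 by rewrite e0/=; apply: (le_trans e16); lra.
have [k [T [n [h [n0 hmom]]]]] := parameters c m L0 e1 kap0.
have [N [f [hN bf hf]]] := alg #|idx k T n|.
pose PE := pw (pw (pw (@U01 R) n) T) k.
pose PD := pprod (pw PE N) (@U01 R).
pose ev := envol k T n L m; have ev0 : 0 < ev := envol_gt0 k T n0 L m.
pose v a : R := expR (- (L * a%:R)) * ev.
have v0 a : 0 < v a by rewrite mulr_gt0 ?expR_gt0.
(* A factor 2 for the volume of the random body around [v a], and a factor C for the algorithm. *)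
pose psi a := accept f (v a / (2 * C)) (2 * C * v a).
have bpsi a : bmf (psi a) by exact: bmf_accept.
pose W0 (z : N.-tuple (k.-tuple (T.-tuple (n.-tuple (measurableTypeR R)))) * measurableTypeR R) : R :=
  \prod_i env L m (tnth z.1 i).
have bW1 : bmf (fun X : N.-tuple (k.-tuple (T.-tuple (n.-tuple (measurableTypeR R)))) => \prod_i env L m (tnth X i)).
  by apply: bmf_prod => i _; apply: bmf_tnth; exact: bmf_env.
have bW0 : bmf W0 by exact: (bmf_comp measurable_fst bW1).
have W00 z : 0 <= W0 z by apply: prodr_ge0 => i _; exact: expR_ge0.
(* The factor e^(-L a N) cancels, so the windows for all a are tested under one and the same law, of
   density [W0] / ev^N. *)
have main a : (a < m)%N -> p / 2 - e <= Ex PD (fun z => W0 z * psi a z) / ev ^+ N.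
  move=> /ltnW am.
  have mc s : bmf (fun x => (@ccut R k T n h s x)%:R : R) by exact: bmf_ccut.
  have lam0 : forall s, 0 <= @clam R k T n h L m a s by exact: clam_ge0.
  have := @family_test R _ _ PE _ _ _ mc lam0 _ _ (@U01 R) (wenv L m a) (v a) e p N (psi a)
    (bmf_wenv k T n L m a) (wenv_le h n0 L0 am) (Ex_wenv k T n L m a) (v0 a)
    (hmom N hN a am N _) (hmom N hN a am N.+2 _) (bpsi a).
  rewrite leqnn 2?leqW// => /(_ isT isT) H.
  have {H} : p * ((1 - 8 * e) * v a ^+ N) <=
      Ex PD (fun z => (\prod_i wenv L m a (tnth z.1 i)) * psi a z) + e * v a ^+ N.
    apply: H => [z||w _ /andP[w1 w2]]; [by rewrite /psi /accept ler0n lern1 leq_b1|exact: ltW|].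
    have := hf _ (body_convex_body w); rewrite volume_body/= success_prob// lee_fin.
    move=> hw; apply: (le_trans hw); apply: Ex_le => [||z].
    - by apply: bmfM; [exact: (bmf_comp measurable_fst (bmf_kept_prod mc N w))|exact: bmf_accept].
    - by apply: bmfM; [exact: (bmf_comp measurable_fst (bmf_kept_prod mc N w))|exact: bpsi].
    apply: ler_wpM2l; first by apply: prodr_ge0 => i _; exact: ler0n.
    rewrite /psi /accept ler_nat; case: (boolP (_ <= _ <= _)) => // /andP[f1 f2].
    have -> // : v a / (2 * C) <= f (unpack (sample z)) <= 2 * C * v a.
    apply/andP; split.
      by apply: le_trans f1; rewrite invfM mulrA ler_pM2r ?invr_gt0.
    by apply: (le_trans f2); rewrite -mulrA mulrCA ler_pM2l.
  have vN : v a ^+ N = expR (- (L * a%:R)) ^+ N * ev ^+ N by rewrite exprMn.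
  have -> : (fun z => (\prod_i wenv L m a (tnth z.1 i)) * psi a z) =
      (fun z => expR (- (L * a%:R)) ^+ N * (W0 z * psi a z)).
    apply/funext => z; rewrite mulrA /W0; congr (_ * _).
    by rewrite /wenv big_split/= prodr_const card_ord.
  rewrite ExZ; last exact: bmfM.
  rewrite vN; set X := Ex _ _; set x := expR _ ^+ N => H.
  have x0 : 0 < x by rewrite exprn_gt0 ?expR_gt0.
  have y0 : 0 < ev ^+ N by rewrite exprn_gt0.
  rewrite ler_pdivlMr// -(ler_pM2l x0); move: H.
  set y := ev ^+ N in y0 *; have xy0 : 0 < x * y by rewrite mulr_gt0.
  set w := x * y in xy0 *; set w' := x * X.
  have -> : x * ((p / 2 - e) * y) = (p / 2 - e) * w by rewrite /w; ring.
  move=> H; rewrite mulrBl lerBlDr; apply: le_trans H.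
  rewrite [leRHS]mulrA; apply: ler_wpM2r; first exact: ltW.
  by apply: ler_wpM2l; [exact: ltW|lra].
have sumpsi z : \sum_(a < m) psi a z <= 1.
  apply: sum_disjoint_le1 => a b ab.
  exact: (@intervals_disjoint R L C ev _ a b C0 (lexx L) ev0 ab).
have tot : \sum_(a < m) Ex PD (fun z => W0 z * psi a z) <= ev ^+ N.
  rewrite -Ex_sum => [|a _]; last exact: bmfM.
  rewrite -(Ex_pw_expn PE N (bmf_env k T n L m)) -(Ex_pprod_fst PE (@U01 R) bW1).
  apply: Ex_le => [||z]; [by apply: bmf_sum => a _; exact: bmfM|exact: bW0|].
  by rewrite -mulr_sumr -[leRHS]mulr1 ler_wpM2l.
have : \sum_(a < m) (p / 2 - e) <= 1.
  apply: (@le_trans _ _ (\sum_(a < m) Ex PD (fun z => W0 z * psi a z) / ev ^+ N)).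
    by apply: ler_sum => a _; exact: main.
  by rewrite -mulr_suml ler_pdivrMr ?exprn_gt0// mul1r.
rewrite sumr_const card_ord -mulr_natl.
have m1 : 0 <= m%:R :> R by [].
nra.
Qed.
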